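(* For every $n$-dimensional generalized real Bott manifold $M^n$ there is an $n\times n$ binary matrix $A$ with zero diagonal such that (i) the facets-pairing structure $\mathcal{F}_A$ on $\mathcal{C}^n$ is strong, and (ii) the seal space $Q^n_{\mathcal{F}_A}$ is homeomorphic to $M^n$.
   Context: A generalized real Bott manifold is a manifold $M^n=B_m$ admitting a sequence of fiber bundles $B_m\to B_{m-1}\to\dots\to B_1\to B_0=\{\mathrm{pt}\}$ where each $B_i$ is the projectivization of a Whitney sum of finitely many real line bundles over $B_{i-1}$. $\mathcal{C}^n=\{x\in\mathbb{R}^n: -\tfrac14\le x_i\le\tfrac14\}$; $\mathbf{F}(i)$, $\mathbf{F}(-i)$ ($1\le i\le n$) are the facets in $\{x_i=\tfrac14\}$, $\{x_i=-\tfrac14\}$. Binary matrices have entries in $\mathbb{Z}_2$; $A^i_k$ denotes the $(i,k)$ entry as $0$ or $1$. $\mathcal{F}_A$ pairs $\mathbf{F}(j)$ with $\mathbf{F}(-j)$ via $\tau^A_j:\mathbf{F}(j)\to\mathbf{F}(-j)$, $\tau^A_j(x)=y$ with $y_{|j|}=-x_{|j|}$ and $y_k=(-1)^{A^{|j|}_k}x_k$ for $k\ne|j|$. $Q^n_{\mathcal{F}_A}$ is the quotient of $\mathcal{C}^n$ by the equivalence relation generated by $x\sim\tau^A_j(x)$. A composition $\tau^A_{k_m}\circ\dots\circ\tau^A_{k_1}$ applied to a proper face $f$ is valid if $f\subset\mathbf{F}(k_1)$ and $\tau^A_{k_i}\circ\dots\circ\tau^A_{k_1}(f)\subset\mathbf{F}(k_{i+1})$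 for $1\le i<m$ ($m=0$ allowed). For a proper face $f$ let $\Xi(f)$ be the set of facets containing $f$; if $f\subset\mathbf{F}(k)$ and $f'=\tau^A_k(f)$, define $\Psi^f_k:\Xi(f)\to\Xi(f')$ by $\Psi^f_k(\mathbf{F}(k))=\mathbf{F}(-k)$ and, for other $F'\in\Xi(f)$, $\Psi^f_k(F')$ is the facet $G$ with $G\cap\mathbf{F}(-k)=\tau^A_k(F'\cap\mathbf{F}(k))$. $\mathcal{F}_A$ is strong if for every proper face $f$ and any two valid compositions mapping $f$ onto the same face $\widetilde f$: (a) they agree at every point of $f$; and (b) the corresponding composites of the maps $\Psi$ coincide as maps $\Xi(f)\to\Xi(\widetilde f)$. *)

(* Defs.v *)
From HB Require Import structures.
From mathcomp Require Import all_boot all_order all_algebra.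
From mathcomp Require Import all_classical all_reals all_analysis.
From mathcomp Require Import Rstruct Rstruct_topology.
From Stdlib Require Import Relations.Relation_Operators.

Set Implicit Arguments.
Unset Strict Implicit.
Unset Printing Implicit Defensive.

Import Order.TTheory GRing.Theory Num.Theory.
Local Open Scope classical_set_scope.
Local Open Scope ring_scope.

Notation RR := Rdefinitions.R.

Definition homeo_on {X Y : topologicalType} (A : set X) (B : set Y)
  (f : X -> Y) : Prop :=
  exists g : Y -> X,
    [/\ {within A, continuous f}, {within B, continuous g},
        f @` A = B, g @` B = A &
        (forall x, A x -> g (f x) = x) /\ (forall y, B y -> f (g y) = y)].

Definition quotient_map_on {X Y : topologicalType} (A : set X)
  (q : X -> Y) (r : X -> X -> Prop) : Prop :=
  [/\ (forall y : Y, exists2 x, A x & q x = y),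
      (forall x y, A x -> A y -> (q x = q y <-> r x y)) &
      (forall U : set Y,
          open U <-> exists V : set X, open V /\ V `&` A = q @^-1` U `&` A)].

Record line_bundle (B : topologicalType) := LineBundle {
  lb_E : topologicalType;
  lb_p : lb_E -> B;
  lb_sc : RR -> lb_E -> lb_E;
  lb_p_cont : continuous lb_p;
  lb_sc_p : forall c e, lb_p (lb_sc c e) = lb_p e;
  lb_loc : forall b : B, exists U : set B, [/\ open U, U b &
     exists phi : lb_E -> RR,
       homeo_on (lb_p @^-1` U) (U `*` setT) (fun e => (lb_p e, phi e)) /\
       (forall c e, U (lb_p e) -> phi (lb_sc c e) = c * phi e)]
}.

(** Total space of the Whitney sum [L_0 (+) ... (+) L_k], as the fibre
    product inside the product of the total spaces, minus the zero
    section. *)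
Definition whitney_nonzero (B : topologicalType) (k : nat)
  (L : 'I_k.+1 -> line_bundle B) : set (prod_topology (fun i => lb_E (L i))) :=
  [set e | (forall i, lb_p (e i) = lb_p (e ord0)) /\
           (exists i, e i <> lb_sc 0 (e i))].

Definition proj_rel (B : topologicalType) (k : nat)
  (L : 'I_k.+1 -> line_bundle B)
  (e e' : prod_topology (fun i => lb_E (L i))) : Prop :=
  exists2 c : RR, c <> 0 & e' = (fun i => lb_sc c (e i)).

Definition is_projectivization (B X : topologicalType) (k : nat)
  (L : 'I_k.+1 -> line_bundle B) : Prop :=
  exists q : prod_topology (fun i => lb_E (L i)) -> X,
    quotient_map_on (@whitney_nonzero B k L) q (@proj_rel B k L).

Inductive gen_real_bott : nat -> topologicalType -> Prop :=
| GRB_pt : forall X : topologicalType,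
    (exists x : X, forall y : X, y = x) -> gen_real_bott 0 X
| GRB_step : forall (d k : nat) (B X : topologicalType)
    (L : 'I_k.+1 -> line_bundle B),
    gen_real_bott d B -> is_projectivization X L ->
    gen_real_bott (d + k) X.

Definition Rn (n : nat) := {ptws 'I_n -> RR}.

Definition quarter : RR := 4^-1.

Definition cube (n : nat) : set (Rn n) :=
  [set x | forall i, - quarter <= x i <= quarter].

(** Signed indices: [(i, true)] stands for [i+1], [(i, false)] for [-(i+1)]. *)
Definition sidx (n : nat) := ('I_n * bool)%type.

Definition sopp (n : nat) (j : sidx n) : sidx n := (j.1, ~~ j.2).

Definition facet (n : nat) (j : sidx n) : set (Rn n) :=
  [set x | cube x /\ x j.1 = (if j.2 then quarter else - quarter)].

Definition msign (n : nat) (A : 'M['F_2]_n) (i k : 'I_n) : RR :=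
  if A i k == 1 then -1 else 1.

(** The pairing map [tau^A_j] (given by its formula on all of R^n; it is
    only ever applied on [F(j)]). *)
Definition tau (n : nat) (A : 'M['F_2]_n) (j : sidx n) (x : Rn n) : Rn n :=
  fun k => if k == j.1 then - x k else msign A j.1 k * x k.

Definition seal_rel (n : nat) (A : 'M['F_2]_n) (x y : Rn n) : Prop :=
  exists j, facet j x /\ y = tau A j x.

Definition seal_equiv (n : nat) (A : 'M['F_2]_n) : Rn n -> Rn n -> Prop :=
  clos_refl_sym_trans (Rn n) (seal_rel A).

Definition homeomorphic_to_seal_space (n : nat) (A : 'M['F_2]_n)
  (X : topologicalType) : Prop :=
  exists q : Rn n -> X, quotient_map_on (@cube n) q (seal_equiv A).

(** Faces of the cube, indexed by partial sign patterns: coordinate [i] is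
    fixed to [+1/4] ([Some true]), to [-1/4] ([Some false]), or free
    ([None]). *)
Definition face_set (n : nat) (s : 'I_n -> option bool) : set (Rn n) :=
  [set x | cube x /\ forall i,
     match s i with
     | Some b => x i = (if b then quarter else - quarter)
     | None => True
     end].

Definition proper_face_pat (n : nat) (s : 'I_n -> option bool) : Prop :=
  exists i, s i <> None.

Definition tau_seq (n : nat) (A : 'M['F_2]_n) (ks : seq (sidx n))
  (x : Rn n) : Rn n :=
  foldl (fun y j => tau A j y) x ks.

Fixpoint valid (n : nat) (A : 'M['F_2]_n) (ks : seq (sidx n))
  (f : set (Rn n)) : Prop :=
  match ks with
  | [::] => True
  | j :: ks' => f `<=` facet j /\ valid A ks' (tau A j @` f)
  end.

Definition psi (n : nat) (A : 'M['F_2]_n) (k F' : sidx n) : option (sidx n) :=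
  if F' == k then Some (sopp k)
  else [pick G : sidx n |
          `[< facet G `&` facet (sopp k) = tau A k @` (facet F' `&` facet k) >] ].

Definition psi_seq (n : nat) (A : 'M['F_2]_n) (ks : seq (sidx n))
  (F' : sidx n) : option (sidx n) :=
  foldl (fun o j => obind (psi A j) o) (Some F') ks.

Definition strong (n : nat) (A : 'M['F_2]_n) : Prop :=
  forall s : 'I_n -> option bool, proper_face_pat s ->
  forall ks ks' : seq (sidx n),
    valid A ks (face_set s) -> valid A ks' (face_set s) ->
    tau_seq A ks @` face_set s = tau_seq A ks' @` face_set s ->
    (forall x, face_set s x -> tau_seq A ks x = tau_seq A ks' x) /\
    (forall F' : sidx n, face_set s `<=` facet F' ->
       psi_seq A ks F' = psi_seq A ks' F').

(* Main.v *)
Require Import Defs.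
From HB Require Import structures.
From mathcomp Require Import all_boot all_order all_algebra.
From mathcomp Require Import all_classical all_reals all_analysis.
From mathcomp Require Import Rstruct Rstruct_topology.
From mathcomp Require Import ring lra.

Set Implicit Arguments.
Unset Strict Implicit.
Unset Printing Implicit Defensive.

Import Order.TTheory GRing.Theory Num.Theory.
Import numFieldNormedType.Exports.
Local Open Scope classical_set_scope.
Local Open Scope ring_scope.

(* Induct along the tower of projectivizations, keeping [M] Hausdorff.  If [B]
   is a quotient of the cube, a line bundle over [B] pulls back to a trivial
   bundle on the cube; a unit section [s] for some norm then satisfies
   [s (tau_j x) = c_j s x] with a constant sign [c_j] on each facet, because
   facets are convex and opposite facets are swapped by an involution.  With
   unit sections [s_0, ..., s_k] of the summands, the point [(x, y)] of the
   larger cube goes to the line spanned by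
   [((1/4 - |y|) s_0(x), y_1 s_1(x), ..., y_k s_k(x))].  Two points have the
   same image exactly when they are related by the matrix with blocks [A] and
   [E] above [0] and [J], where [J] is [1] off the diagonal (antipodal map on
   the boundary of the new coordinates) and [E] records the signs
   [c_j(s_0) c_j(s_m)].  Strongness is a property of sign vectors that the block
   construction preserves because the signs [c_j] are a holonomy. *)

(** * Pointwise topology and boxes *)

Lemma prod_topology_continuous_at (I : Type) (K : I -> topologicalType)
  (T : topologicalType) (f : T -> prod_topology K) (t : T) :
  (forall i, {for t, continuous (fun u => f u i)}) -> {for t, continuous f}.
Proof.
move=> cf; apply/cvg_sup => i U [V] [[W] oW <-] Wf WU.
apply: (filterS WU); apply: (cf i).
by apply: open_nbhs_nbhs; split.
Qed.

Lemma prod_topology_continuous (I : Type) (K : I -> topologicalType)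
  (T : topologicalType) (f : T -> prod_topology K) :
  (forall i, continuous (fun u => f u i)) -> continuous f.
Proof. by move=> cf t; apply: prod_topology_continuous_at => i; exact: cf. Qed.

Lemma proj_prod_continuous (I : eqType) (K : I -> topologicalType) (i : I) :
  continuous (fun f : prod_topology K => f i).
Proof. exact: (@proj_continuous I K i). Qed.

Lemma coord_continuous (n : nat) (i : 'I_n) :
  continuous (fun x : Rn n => x i).
Proof. exact: (@proj_prod_continuous _ (fun _ : 'I_n => RR)). Qed.

Definition box_ball (n : nat) (x : Rn n) (e : RR) : set (Rn n) :=
  [set y | forall i, `|y i - x i| < e].

(** The boxes of positive radius generate a filter that converges to [x] in every coordinate, hence
    converges for the product topology, which is a supremum of initial topologies. *)
Lemma nbhs_box_ball (n : nat) (x : Rn n) (U : set (Rn n)) :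
  nbhs x U -> exists2 e, 0 < e & box_ball x e `<=` U.
Proof.
pose G := filter_from [set e : RR | 0 < e] (box_ball x).
have FG : Filter G.
  apply: filter_from_filter; first by exists 1 => /=.
  move=> e1 e2 /= p1 p2; exists (Num.min e1 e2); first by rewrite /= lt_min p1 p2.
  by move=> y yx; split=> i; have := yx i; rewrite lt_min => /andP[].
have GC : G --> x.
  apply/cvg_sup => i V [V'] [[W] oW <-] Wf WV.
  have : nbhs (x i) W by apply: open_nbhs_nbhs.
  case/nbhs_ballP => e e0 eW; exists e => // y /(_ i) yx.
  by apply/WV/eW; rewrite /ball /= distrC.
by move=> /GC [e e0 eU]; exists e.
Qed.

Lemma box_ball_nbhs (n : nat) (x : Rn n) (e : RR) :
  0 < e -> nbhs x (box_ball x e).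
Proof.
move=> e0.
apply: (@filter_forall (Rn n) _ (fun i y => `|y i - x i| < e) (nbhs x)) => i.
apply: (@coord_continuous n i x [set r | `|r - x i| < e]).
apply/nbhs_ballP; exists e => // r; by rewrite /ball /= distrC.
Qed.

(** * Continuity of real-valued functions *)

Lemma continuousV_at (T : topologicalType) (f : T -> RR) (x : T) :
  f x != 0 -> {for x, continuous f} -> {for x, continuous (fun y => (f y)^-1)}.
Proof. by move=> f0 cf; exact: (@continuousV _ _ f x f0 cf). Qed.

Lemma continuous_maxr (T : topologicalType) (f g : T -> RR) :
  continuous f -> continuous g -> continuous (fun x => Num.max (f x) (g x)).
Proof. by move=> cf cg x; apply: (@continuous_max RR T f g x (cf x) (cg x)). Qed.

Lemma continuous_minr (T : topologicalType) (f g : T -> RR) :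
  continuous f -> continuous g -> continuous (fun x => Num.min (f x) (g x)).
Proof. by move=> cf cg x; apply: (@continuous_min RR T f g x (cf x) (cg x)). Qed.

Lemma continuousD_at (T : topologicalType) (f g : T -> RR) (x : T) :
  {for x, continuous f} -> {for x, continuous g} ->
  {for x, continuous (fun y => f y + g y)}.
Proof. by move=> cf cg; apply: (@continuousD RR RR^o T f g x). Qed.

Lemma continuousM_at (T : topologicalType) (f g : T -> RR) (x : T) :
  {for x, continuous f} -> {for x, continuous g} ->
  {for x, continuous (fun y => f y * g y)}.
Proof. by move=> cf cg; exact: (cvgM cf cg). Qed.

Lemma continuous_norm_at (T : topologicalType) (f : T -> RR) (x : T) :
  {for x, continuous f} -> {for x, continuous (fun y => `|f y|)}.
Proof. by move=> cf; apply: (@cvg_norm RR RR^o). Qed.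

Lemma continuous_sum_at (T : topologicalType) (I : Type) (r : seq I)
  (f : I -> T -> RR) (x : T) :
  (forall i, {for x, continuous (f i)}) ->
  {for x, continuous (fun y => \sum_(i <- r) f i y)}.
Proof.
move=> cf; elim: r => [|i r IH].
  rewrite (_ : (fun y => _) = fun=> 0); first exact: cst_continuous.
  by apply/funext => y; rewrite big_nil.
rewrite (_ : (fun y => _) = (fun y => f i y + \sum_(j <- r) f j y)).
  exact: (continuousD_at (cf i) IH).
by apply/funext => y; rewrite big_cons.
Qed.

(** The coordinatewise retraction onto a box. Composing with it turns a map that is controlled only
    on the box into one controlled on the whole space. *)
Definition clamp (n : nat) (a b : 'I_n -> RR) (x : Rn n) : Rn n :=
  fun i => Num.max (a i) (Num.min (b i) (x i)).

Definition box (n : nat) (a b : 'I_n -> RR) : set (Rn n) :=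
  [set x | forall i, a i <= x i <= b i].

Lemma clamp_continuous (n : nat) (a b : 'I_n -> RR) : continuous (clamp a b).
Proof.
apply: prod_topology_continuous => i.
apply: continuous_maxr; first exact: cst_continuous.
by apply: continuous_minr; [exact: cst_continuous | exact: coord_continuous].
Qed.

Lemma clamp_box (n : nat) (a b : 'I_n -> RR) (x : Rn n) :
  (forall i, a i <= b i) -> box a b (clamp a b x).
Proof.
move=> ab i; rewrite /clamp le_max lexx /= ge_max ab /=.
by rewrite ge_min lexx.
Qed.

Lemma clamp_id (n : nat) (a b : 'I_n -> RR) (x : Rn n) :
  box a b x -> clamp a b x = x.
Proof.
move=> bx; apply/funext => i; rewrite /clamp; have /andP[ax xb] := bx i.
by rewrite (min_idPr xb) (max_idPr ax).
Qed.

Lemma quarter_gt0 : 0 < quarter.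
Proof. by rewrite /quarter invr_gt0. Qed.

Lemma quarter_ge0 : 0 <= quarter. Proof. exact: ltW quarter_gt0. Qed.

Lemma compact_cube (n : nat) : compact (@cube n).
Proof.
have := @tychonoff 'I_n (fun=> RR) (fun=> [set r | r \in `[- quarter, quarter]])
  (fun=> @segment_compact _ _ _).
rewrite (_ : [set _ | _] = @cube n) //.
Qed.

Lemma cube_normP (n : nat) (x : Rn n) :
  cube x <-> forall i, `|x i| <= quarter.
Proof. by split=> h i; have := h i; rewrite ler_norml. Qed.

Definition cube_clamp (n : nat) : Rn n -> Rn n :=
  clamp (fun=> - quarter) (fun=> quarter).

Lemma cube_clampP (n : nat) (x : Rn n) : cube (cube_clamp x).
Proof. by apply: clamp_box => i; rewrite ge0_cp // quarter_ge0. Qed.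

Lemma cube_clamp_id (n : nat) (x : Rn n) : cube x -> cube_clamp x = x.
Proof. exact: clamp_id. Qed.

(** * Signs of facet pairings and strongness *)

(** Each pairing map is the restriction of a diagonal linear map, the same one for [F(i)] and
    [F(-i)]; these are its diagonal entries, including the flip of coordinate [i] itself. *)
Definition tsign (n : nat) (A : 'M['F_2]_n) (i k : 'I_n) : RR :=
  if k == i then -1 else msign A i k.

Definition sgn (n : nat) (A : 'M['F_2]_n) (l : seq 'I_n) (k : 'I_n) : RR :=
  \prod_(i <- l) tsign A i k.

(* [sgn A l = 1] says that the linear maps [tau_i], [i] in [l], compose to the
   identity; the condition is that this can be read off the coordinates in
   [l], the only ones that are fixed on a face where they compose validly. *)
Definition support_detects_identity (n : nat) (A : 'M['F_2]_n) : Prop :=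
  forall l : seq 'I_n, (forall k, k \in l -> sgn A l k = 1) ->
    forall k, sgn A l k = 1.

Section Signs.
Variables (n : nat) (A : 'M['F_2]_n).
Implicit Types (i k : 'I_n) (j : sidx n) (l : seq 'I_n) (x : Rn n)
  (ks : seq (sidx n)).

Lemma tsignP i k : tsign A i k = 1 \/ tsign A i k = -1.
Proof.
rewrite /tsign /msign; case: ifP => _; first by right.
by case: ifP => _; [right|left].
Qed.

Lemma tsign_sq i k : tsign A i k * tsign A i k = 1.
Proof. by case: (tsignP i k) => ->; rewrite ?mulrNN mulr1. Qed.

Lemma tsign_diag i : tsign A i i = -1.
Proof. by rewrite /tsign eqxx. Qed.

Lemma norm_tsign i k : `|tsign A i k| = 1.
Proof. by case: (tsignP i k) => ->; rewrite ?normrN normr1. Qed.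

Lemma tauE j x k : tau A j x k = tsign A j.1 k * x k.
Proof. by rewrite /tau /tsign; case: ifP => // _; rewrite mulN1r. Qed.

Lemma tau_tau i b b' x : tau A (i, b) (tau A (i, b') x) = x.
Proof. by apply/funext => k; rewrite !tauE /= mulrA tsign_sq mul1r. Qed.

Lemma sgn_nil k : sgn A [::] k = 1.
Proof. by rewrite /sgn big_nil. Qed.

Lemma sgn_cons i l k : sgn A (i :: l) k = tsign A i k * sgn A l k.
Proof. by rewrite /sgn big_cons. Qed.

Lemma sgn_cat l l' k : sgn A (l ++ l') k = sgn A l k * sgn A l' k.
Proof. by rewrite /sgn big_cat. Qed.

Lemma sgnP l k : sgn A l k = 1 \/ sgn A l k = -1.
Proof.
elim: l => [|i l IH]; first by left; rewrite sgn_nil.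
rewrite sgn_cons; case: (tsignP i k) => ->; case: IH => ->;
  rewrite ?mul1r ?mulN1r ?opprK; by [left|right].
Qed.

Lemma sgn_sq l k : sgn A l k * sgn A l k = 1.
Proof. by case: (sgnP l k) => ->; rewrite ?mulrNN mulr1. Qed.

Lemma tau_seqE ks x k : tau_seq A ks x k = sgn A (map fst ks) k * x k.
Proof.
elim: ks x => [|j ks IH] x; first by rewrite sgn_nil mul1r.
by rewrite /= (IH (tau A j x)) sgn_cons tauE mulrCA mulrA.
Qed.

Lemma quarter_neqN : quarter != - quarter.
Proof. by rewrite -subr_eq0 opprK gt_eqF // addr_gt0 // quarter_gt0. Qed.

Definition side (b : bool) : RR := if b then quarter else - quarter.

Lemma side_inj b b' : side b = side b' -> b = b'.
Proof.
have := quarter_neqN; case: b; case: b' => //= /eqP; rewrite /side //.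
by move=> h1 h2; case: h1.
Qed.

Lemma side_neq0 b : side b != 0.
Proof. by case: b; rewrite /side ?oppr_eq0 gt_eqF // quarter_gt0. Qed.

Lemma norm_side b : `|side b| = quarter.
Proof. by case: b; rewrite /side ?normrN gtr0_norm // quarter_gt0. Qed.

Lemma sideN b : side (~~ b) = - side b.
Proof. by case: b; rewrite /side ?opprK. Qed.

Lemma norm_quarterP (r : RR) : `|r| = quarter -> exists b, r = side b.
Proof.
move=> rq; exists (0 <= r); rewrite /side -rq.
by case: (lerP 0 r) => r0; [rewrite ger0_norm | rewrite ltr0_norm // opprK].
Qed.

Lemma facet_cube j x : facet j x -> cube x.
Proof. by case. Qed.

Lemma tau_cube j x : cube x -> cube (tau A j x).
Proof.
move/cube_normP => cx; apply/cube_normP => k.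
by rewrite tauE normrM norm_tsign mul1r.
Qed.

Lemma tau_facet i b x : facet (i, b) x -> facet (i, ~~ b) (tau A (i, b) x).
Proof.
case=> cx xi; split; first exact: tau_cube.
by rewrite tauE /= tsign_diag mulN1r -/(side _) sideN; congr (- _).
Qed.

Lemma seal_rel_sym x y : seal_rel A x y -> seal_rel A y x.
Proof.
case=> -[i b] [xi ->]; exists (i, ~~ b); split; first exact: tau_facet.
by rewrite tau_tau.
Qed.

Lemma seal_relP i x : cube x -> `|x i| = quarter ->
  seal_rel A x (tau A (i, true) x).
Proof. by move=> cx /norm_quarterP[b xb]; exists (i, b). Qed.

(** A test point of the face: it lies on no facets except those fixed by [s], so inclusions of the
    face in facets can be read off [s]. *)
Definition face_center (s : 'I_n -> option bool) : Rn n :=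
  fun i => if s i is Some b then side b else 0.

Lemma face_centerP s : face_set s (face_center s).
Proof.
split; last by move=> i; rewrite /face_center; case: (s i).
apply/cube_normP => i; rewrite /face_center; case: (s i) => [b|].
  by rewrite norm_side.
by rewrite normr0 quarter_ge0.
Qed.

Lemma facet_face_center s j : facet j (face_center s) -> s j.1 = Some j.2.
Proof.
case: j => i b [_ /=]; rewrite -/(side b) /face_center.
case: (s i) => [b' /side_inj -> //|] /eqP.
by rewrite eq_sym (negbTE (side_neq0 b)).
Qed.

Lemma face_sub_facet s j : face_set s `<=` facet j -> s j.1 = Some j.2.
Proof. by move/(_ _ (face_centerP s))/facet_face_center. Qed.

Definition tau_pat j (s : 'I_n -> option bool) : 'I_n -> option bool :=
  fun k => if s k is Some b then Some (b (+) (tsign A j.1 k == -1)) else None.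

Lemma N1_neq1 : (-1 : RR) != 1.
Proof. by rewrite -subr_eq0 -opprD oppr_eq0 gt_eqF. Qed.

Lemma side_tsign i k b :
  side (b (+) (tsign A i k == -1)) = tsign A i k * side b.
Proof.
case: (tsignP i k) => ->; last by rewrite eqxx addbT sideN mulN1r.
by rewrite eq_sym (negbTE N1_neq1) addbF mul1r.
Qed.

Lemma tau_face_set j s :
  tau A j @` face_set s = face_set (tau_pat j s).
Proof.
case: j => i b; apply/seteqP; split => [_ [x [cx xs] <-]|y [cy ys]].
  split; first exact: tau_cube.
  move=> k; rewrite /tau_pat; have := xs k; case: (s k) => // c xk.
  by rewrite -/(side _) side_tsign tauE xk.
exists (tau A (i, b) y); last by rewrite tau_tau.
split; first exact: tau_cube.
move=> k; have := ys k; rewrite /tau_pat; case: (s k) => // c.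
by rewrite -/(side _) side_tsign tauE => ->; rewrite mulrA tsign_sq mul1r.
Qed.

(** Pairing maps only flip signs in a pattern and never free or fix a coordinate. So a coordinate
    that is fixed when its pairing map is applied was already fixed on the initial face. *)
Lemma valid_support ks s :
  valid A ks (face_set s) -> forall k, k \in map fst ks -> s k <> None.
Proof.
elim: ks s => [//|[i b] ks IH] s [/face_sub_facet /= si].
rewrite tau_face_set => /IH{}IH k; rewrite inE => /orP[/eqP -> /=|/IH].
  by rewrite si.
by rewrite /tau_pat; case: (s k).
Qed.

Definition pair_pat j1 j2 : 'I_n -> option bool :=
  fun k => if k == j1.1 then Some j1.2 else
           if k == j2.1 then Some j2.2 else None.

Lemma pair_patP j1 j2 : j1.1 != j2.1 ->
  face_set (pair_pat j1 j2) = facet j2 `&` facet j1.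
Proof.
move=> j12; apply/seteqP; split => x.
  move=> [cx xs]; split; split => //.
    by have := xs j2.1; rewrite /pair_pat eq_sym (negbTE j12) eqxx.
  by have := xs j1.1; rewrite /pair_pat eqxx.
move=> [[cx x2] [_ x1]]; split => // i; rewrite /pair_pat.
by case: eqP => [->|_] //; case: eqP => [->|].
Qed.

(** The pairing map acts on patterns by flipping signs, which gives one solution of the equation
    defining [psi]; the work lies in showing that the solution is unique. *)
Lemma psi_facet j G s : face_set s `<=` facet j -> face_set s `<=` facet G ->
  psi A j G = Some (G.1, G.2 (+) (tsign A j.1 G.1 == -1)).
Proof.
case: j G => [i b] [g c] /face_sub_facet /= si /face_sub_facet /= sg.
rewrite /psi; case: eqP => [[-> ->]|ne].
  by rewrite /= tsign_diag eqxx addbT.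
have gi : g != i.
  by apply/eqP => gi; move: sg si ne; rewrite gi => -> [->].
pose G' : sidx n := (g, c (+) (tsign A i g == -1)).
have facets_eq : facet G' `&` facet (sopp (i, b)) =
   tau A (i, b) @` (facet (g, c) `&` facet (i, b)).
  have ig : i != g by rewrite eq_sym.
  rewrite -(@pair_patP (sopp (i, b)) G') // -(@pair_patP (i, b) (g, c)) //.
  rewrite tau_face_set; congr face_set; apply/funext => k.
  rewrite /tau_pat /pair_pat /=; case: eqP => [->|_].
    by rewrite tsign_diag eqxx addbT.
  by case: eqP => [->|].
case: pickP => [H /asboolP|/(_ G')]; last first.
  by rewrite (introT (asboolP _) facets_eq).
rewrite -facets_eq => HG.
(* The centre of this codimension-two face has only two fixed coordinates, so [H] is either [G'] or
   the facet opposite to [(i, b)]. *)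
have [] : (facet H `&` facet (sopp (i, b)))
    (face_center (pair_pat (sopp (i, b)) G')).
  rewrite HG -(@pair_patP (sopp (i, b)) G'); first exact: face_centerP.
  by rewrite /= eq_sym.
move=> /facet_face_center; rewrite /pair_pat /=.
case: eqP => [Hi [Hb] _|_]; last first.
  by case: eqP => // Hg [Hc] _; case: H Hg Hc {HG} => h d /= -> <-.
have HE : H = sopp (i, b) by case: H Hi Hb {HG} => h d /= -> <-.
(* In the second case the left side would be a whole facet. Its centre has coordinate [g] equal to
   zero, whereas the right side lies in [facet G']. *)
pose s1 : 'I_n -> option bool := fun k => if k == i then Some (~~ b) else None.
have : (facet H `&` facet (sopp (i, b))) (face_center s1).
  rewrite HE setIid; split; first by have [] := face_centerP s1.
  by rewrite /= /face_center /s1 eqxx.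
rewrite HG => -[/facet_face_center]; rewrite /s1 /=.
by rewrite (negbTE gi).
Qed.

Lemma valid_psi_seq ks s G : valid A ks (face_set s) ->
  face_set s `<=` facet G ->
  psi_seq A ks G = Some (G.1, G.2 (+) (sgn A (map fst ks) G.1 == -1)).
Proof.
elim: ks s G => [|j ks IH] s G.
  by rewrite sgn_nil eq_sym (negbTE N1_neq1) addbF; case: G.
case=> sj vks sG; rewrite /psi_seq /= (psi_facet sj sG).
rewrite tau_face_set in vks.
rewrite -/(psi_seq A ks _) (IH _ _ vks) /=; last first.
  move=> x [cx xs]; split=> //=; have := xs G.1.
  by rewrite /tau_pat (face_sub_facet sG) /= -/(side _).
congr (Some (_, _)); rewrite -addbA; congr (_ (+) _).
rewrite sgn_cons; case: (tsignP j.1 G.1) => ->; case: (sgnP (map fst ks) G.1) => ->;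
  by rewrite ?mul1r ?mulN1r ?opprK ?eqxx ?[1 == -1]eq_sym ?(negbTE N1_neq1).
Qed.

(** Two valid compositions with the same image have equal signs on the fixed coordinates, as the
    centre of the face shows. Signs are their own inverses, so the concatenated word has sign 1
    there, and its letters are all fixed coordinates. The hypothesis then makes the signs equal in
    every coordinate, and these signs determine both the point maps and the maps on facets. *)
Lemma support_detects_identity_strong : support_detects_identity A -> strong A.
Proof.
move=> good s _ ks ks' vks vks' im_eq.
have sgn_eq k : sgn A (map fst ks) k = sgn A (map fst ks') k.
  suff /(_ k) : forall k, sgn A (map fst ks ++ map fst ks') k = 1.
    rewrite sgn_cat => /(congr1 ( *%R^~ (sgn A (map fst ks') k))).
    by rewrite -mulrA sgn_sq mulr1 mul1r.
  apply: good => {}k; rewrite mem_cat => kin.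
  have sk : s k <> None.
    by case/orP: kin; [exact: valid_support vks k | exact: valid_support vks' k].
  case sk_eq: (s k) sk => [b|//] _.
  have : (tau_seq A ks @` face_set s) (tau_seq A ks (face_center s)).
    by exists (face_center s) => //; exact: face_centerP.
  rewrite im_eq => -[y [_ /(_ k)]]; rewrite sk_eq -/(side b) => yk.
  move=> /(congr1 (fun z : Rn n => z k)).
  rewrite !tau_seqE yk /face_center sk_eq => /(mulIf (side_neq0 b)) h.
  by rewrite sgn_cat h sgn_sq.
split=> [x _|G sG]; first by apply/funext => k; rewrite !tau_seqE sgn_eq.
by rewrite (valid_psi_seq vks sG) (valid_psi_seq vks' sG) sgn_eq.
Qed.

End Signs.

(** * Norms and unit vectors of a real line bundle *)

Lemma near_eq_continuous_at (T U : topologicalType) (f g : T -> U) (x : T) :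
  (\forall y \near x, f y = g y) -> {for x, continuous f} ->
  {for x, continuous g}.
Proof.
move=> fg cf; rewrite /prop_for /continuous_at -(nbhs_singleton fg).
by apply: cvg_trans cf; apply: near_eq_cvg; apply: filterS fg.
Qed.

Lemma continuous_pair_at (T U V : topologicalType) (f : T -> U) (g : T -> V)
  (x : T) : {for x, continuous f} -> {for x, continuous g} ->
  {for x, continuous (fun y => (f y, g y))}.
Proof. by move=> cf cg; apply: cvg_pair. Qed.

Lemma continuous_comp_at (T U V : topologicalType) (f : T -> U) (g : U -> V)
  (x : T) : {for x, continuous f} -> {for f x, continuous g} ->
  {for x, continuous (fun y => g (f y))}.
Proof. exact: continuous_comp. Qed.

Lemma norm1_sign (c : RR) : `|c| = 1 -> c = 1 \/ c = -1.
Proof.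
case: (lerP 0 c) => h; first by rewrite ger0_norm //; left.
by rewrite ltr0_norm // => <-; rewrite opprK; right.
Qed.

Definition lb_norm (B : topologicalType) (L : line_bundle B)
  (N : lb_E L -> RR) : Prop :=
  [/\ continuous N, forall c e, N (lb_sc c e) = `|c| * N e,
      forall e, 0 <= N e & forall e, N e = 0 -> e = lb_sc 0 e].

Section LineBundle.
Variables (B : topologicalType) (L : line_bundle B).
Hypothesis hausB : hausdorff_space B.
Hypothesis compB : compact [set: B].
Local Notation E := (lb_E L).
Local Notation p := (@lb_p B L).
Local Notation sc := (@lb_sc B L).

Lemma lb_trivialization (b : B) : exists (U : set B) (phi : E -> RR)
    (g : B * RR -> E),
  [/\ open U, U b,
      (forall e, U (p e) -> {for e, continuous phi}) /\
      (forall z, U z.1 -> {for z, continuous g}),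
      forall z, U z.1 -> p (g z) = z.1 /\ phi (g z) = z.2 &
      (forall e, U (p e) -> g (p e, phi e) = e) /\
      (forall c e, U (p e) -> phi (sc c e) = c * phi e)].
Proof.
have [U [oU Ub [phi [[g [cf cg _ img [gf fg]]] lin]]]] := lb_loc L b.
have oP : open (p @^-1` U) by apply: open_comp => // e _; exact: lb_p_cont.
have oUT : open (U `*` [set: RR]).
  rewrite (_ : _ `*` _ = (fun z : B * RR => z.1) @^-1` U).
    by apply: open_comp => // z _; exact: cvg_fst.
  by apply/seteqP; split=> [[c r] []|[c r]].
exists U, phi, g; split => //.
  split=> [e Ue|z Uz].
    have := cf; rewrite continuous_open_subspace // => /(_ e).
    rewrite inE => /(_ Ue) ce.
    by apply: (@continuous_comp_at _ _ _ (fun e => (p e, phi e)) snd _ ce) cvg_snd.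
  have := cg; rewrite continuous_open_subspace // => /(_ z); apply.
  by rewrite inE; split.
move=> [c r] /= Uc.
have /fg [] : (U `*` [set: RR]) (c, r) by split.
by move=> -> ->.
Qed.

Lemma lb_functional (b : B) : exists (F : E -> RR) (V : set B),
  [/\ open V, V b, continuous F, (forall c e, F (sc c e) = c * F e) &
      forall e e', V (p e) -> p e = p e' -> F e = F e' -> e = e'].
Proof.
have [U [phi [g [oU Ub [cphi _] gP [gphi lin]]]]] := lb_trivialization b.
have [f [cf _ f0 f1]] : exists f : B -> RR, [/\ continuous f,
    range f `<=` `[0, 1], f @` (~` U) `<=` [set 0] & f @` [set b] `<=` [set 1]].
  apply/uniform_separatorP.
  apply: (proj1 (@normal_separatorP RR B) (compact_normal hausB compB)).
  - exact: open_closedC.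
  - exact/accessible_closed_set1/hausdorff_accessible.
  - by apply/seteqP; split => // x [] /= nU xb; apply: nU; rewrite xb.
have fb : f b = 1 by apply: f1; exists b.
have fU c : f c != 0 -> U c.
  move=> fc; apply: contrapT => nU; move/negP: fc; apply; apply/eqP.
  by apply: f0; exists c.
(* Cutting [f] at height 1/2 makes the bump vanish on a neighbourhood of every zero of [f], which
   gives continuity at points where [phi] is uncontrolled. *)
pose la c := Num.max 0 (f c - 2^-1).
have cla : continuous la.
  apply: continuous_maxr; first exact: cst_continuous.
  move=> c; apply: (@continuousD_at B f (fun=> - 2^-1) c); first exact: cf.
  exact: cst_continuous.
have laU c : 0 < la c -> U c.
  rewrite /la lt_max ltxx /= subr_gt0 => h; apply: fU.
  by rewrite gt_eqF // (lt_trans _ h).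
exists (fun e => la (p e) * phi e), [set c | 0 < la c]; split.
- rewrite (_ : [set _ | _] = la @^-1` [set r | 0 < r]) //.
  by apply: open_comp; [move=> c _; exact: cla | exact: open_gt].
- by rewrite /= /la fb lt_max ltxx subr_gt0 /= invf_lt1 ?ltr1n.
- move=> e; have [fe|fe] := eqVneq (f (p e)) 0; last first.
    apply: (@continuousM_at _ (la \o p) phi e); last by apply: cphi; exact: fU.
    by apply: (@continuous_comp_at _ _ _ p la) => //; [exact: lb_p_cont|exact: cla].
  apply: (@near_eq_continuous_at _ _ (fun=> 0 : RR)
    (fun e => la (p e) * phi e) e); last exact: cst_continuous.
  have : nbhs e ((f \o p) @^-1` [set r | r < 2^-1]).
    apply: (@continuous_comp _ _ _ p f e (@lb_p_cont _ L e) (cf _)).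
    by apply: open_nbhs_nbhs; split; [exact: open_lt | rewrite /= fe].
  apply: filterS => e' /= fe'; rewrite /la (max_idPl _) ?mul0r //.
  by rewrite subr_le0 ltW.
- move=> c e; rewrite lb_sc_p; have [le|/laU Ue] := leP (la (p e)) 0.
    suff -> : la (p e) = 0 by rewrite !mul0r mulr0.
    by apply/eqP; rewrite eq_le le /la le_max lexx.
  by rewrite lin // mulrCA.
- move=> e e' /= Ve pe; rewrite -pe => /(mulfI (lt0r_neq0 Ve)) phe.
  have Ue := laU _ Ve.
  by rewrite -(gphi e) // -(gphi e') -?pe // phe.
Qed.

Lemma lb_functional_eq0 (F : E -> RR) (V : set B) :
  (forall c e, F (sc c e) = c * F e) ->
  (forall e e', V (p e) -> p e = p e' -> F e = F e' -> e = e') ->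
  forall e, V (p e) -> e <> sc 0 e -> F e != 0.
Proof.
move=> hF iF e Ve ne; apply/eqP => Fe; apply: ne; apply: iF => //.
  by rewrite lb_sc_p.
by rewrite hF mul0r.
Qed.

Lemma lb_sc1 e : sc 1 e = e.
Proof.
have [F [V [_ Vb _ hF iF]]] := lb_functional (p e).
by apply: iF; rewrite ?lb_sc_p // hF mul1r.
Qed.

Lemma lb_scA c d e : sc c (sc d e) = sc (c * d) e.
Proof.
have [F [V [_ Vb _ hF iF]]] := lb_functional (p e).
by apply: iF; rewrite ?lb_sc_p // !hF mulrA.
Qed.

Lemma lb_sc_inj c d e : e <> sc 0 e -> sc c e = sc d e -> c = d.
Proof.
move=> ne; have [F [V [_ Vb _ hF iF]]] := lb_functional (p e).
move=> /(congr1 F); rewrite !hF; apply: mulIf.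
exact: (lb_functional_eq0 hF iF Vb ne).
Qed.

Lemma lb_span e e' : e <> sc 0 e -> p e = p e' -> exists c, e' = sc c e.
Proof.
move=> ne pe; have [F [V [_ Vb _ hF iF]]] := lb_functional (p e).
have F0 := lb_functional_eq0 hF iF Vb ne.
exists (F e' / F e); apply: iF; rewrite ?lb_sc_p -?pe //.
by rewrite hF divfK.
Qed.

Lemma lb_sc_continuous_at (T : topologicalType) (c : T -> RR) (s : T -> E)
  (t : T) : {for t, continuous c} -> {for t, continuous s} ->
  {for t, continuous (fun u => sc (c u) (s u))}.
Proof.
move=> cc cs.
have [U [phi [g [oU Ub [cphi cg] gP [gphi lin]]]]] := lb_trivialization (p (s t)).
have cps : {for t, continuous (p \o s)}.
  by apply: (continuous_comp_at cs); exact: lb_p_cont.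
apply: (@near_eq_continuous_at _ _ (fun u => g (p (s u), c u * phi (s u)))).
  have : nbhs t ((p \o s) @^-1` U) by apply: cps; exact: open_nbhs_nbhs.
  apply: filterS => u /= Uu; rewrite -lin // -[in RHS](gphi (sc _ _)) lb_sc_p //.
apply: (@continuous_comp_at _ _ _ (fun u => (p (s u), c u * phi (s u))) g).
  apply: continuous_pair_at; first exact: cps.
  apply: (continuousM_at cc); apply: (continuous_comp_at cs); exact: cphi.
exact: cg.
Qed.

(** By compactness finitely many functionals are injective on fibres over sets that cover [B]; the
    sum of their absolute values vanishes only on zero vectors. *)
Lemma lb_norm_exists : exists N : E -> RR, lb_norm N.
Proof.
pose P (b : B) (FV : (E -> RR) * set B) := [/\ open FV.2, FV.2 b,
  continuous FV.1, (forall c e, FV.1 (sc c e) = c * FV.1 e) &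
  forall e e', FV.2 (p e) -> p e = p e' -> FV.1 e = FV.1 e' -> e = e'].
have /choice[f fP] : forall b, exists FV, P b FV.
  by move=> b; have [F [V h]] := lb_functional b; exists (F, V).
have [D cov] : exists D : seq B, forall c, exists2 b, b \in D & (f b).2 c.
  (* The near-covering form of compactness, applied to the filter of lists containing a given list,
     yields a finite subcover. *)
  pose F := filter_from [set: seq B] (fun r => [set r' : seq B | {subset r <= r'}]).
  have FF : Filter F.
    apply: filter_from_filter; first by exists [::].
    move=> r1 r2 _ _; exists (r1 ++ r2) => // r' h.
    by split=> b br; apply: h; rewrite mem_cat br ?orbT.
  have := proj1 (@compact_near_coveringP B _) compB _ F
    (fun r c => exists2 b, b \in r & (f b).2 c) FF.
  case; last by move=> r _ rP; exists r => c; apply: (rP r).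
  move=> b _; have [oV Vb _ _ _] := fP b.
  exists ((f b).2, [set r' : seq B | {subset [:: b] <= r'}]).
    by split; [exact: open_nbhs_nbhs | exists [:: b]].
  by move=> [c r] [/= Vc br]; exists b => //; apply: br; rewrite inE.
exists (fun e => \sum_(b <- D) `|(f b).1 e|); split.
- move=> e; apply: (@continuous_sum_at _ _ D (fun b e => `|(f b).1 e|) e) => b.
  apply: (@continuous_norm_at _ (f b).1 e).
  by have [_ _ c _ _] := fP b; exact: c.
- move=> c e; rewrite mulr_sumr; apply: eq_bigr => b _.
  by have [_ _ _ -> _] := fP b; rewrite normrM.
- by move=> e; apply: sumr_ge0.
- move=> e /eqP; rewrite psumr_eq0 // => /allP h.
  have [b bD Vb] := cov (p e).
  have [_ _ _ hF iF] := fP b; apply: iF; rewrite ?lb_sc_p // hF mul0r.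
  by apply/eqP; rewrite -normr_eq0; apply: (h b).
Qed.

Section Norm.
Variable N : E -> RR.
Hypothesis normN : lb_norm N.

Lemma lb_norm_gt0 e : e <> sc 0 e -> 0 < N e.
Proof.
have [_ _ N0 N00] := normN; move=> ne; rewrite lt0r N0 andbT.
by apply/eqP => /N00.
Qed.

Lemma unit_nonzero e : N e = 1 -> e <> sc 0 e.
Proof.
have [_ NM _ _] := normN => Ne e0; move: Ne.
by rewrite e0 NM normr0 mul0r => /eqP; rewrite eq_sym oner_eq0.
Qed.

Lemma unit_vectors e e' : N e = 1 -> N e' = 1 -> p e = p e' ->
  exists2 c, `|c| = 1 & e' = sc c e.
Proof.
have [_ NM _ _] := normN.
move=> Ne Ne' /(lb_span (unit_nonzero Ne))[c e'E]; exists c => //.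
by move: Ne'; rewrite e'E NM Ne mulr1.
Qed.

Lemma local_unit_section (b : B) : exists (U : set B) (s : B -> E),
  [/\ open U, U b & forall c, U c ->
    [/\ {for c, continuous s}, p (s c) = c & N (s c) = 1]].
Proof.
have [U [phi [g [oU Ub [cphi cg] gP [gphi lin]]]]] := lb_trivialization b.
have [cN NM _ _] := normN.
have g1 c : U c -> 0 < N (g (c, 1)).
  move=> Uc; apply: lb_norm_gt0 => /(congr1 phi).
  have [pg ->] := gP (c, 1) Uc.
  by rewrite lin ?pg // mul0r => /eqP; rewrite oner_eq0.
have cg1 c : U c -> {for c, continuous (fun c => g (c, 1))}.
  move=> Uc; apply: (@continuous_comp_at B (B * RR)%type E (fun c => (c, 1)) g c);
    last exact: cg.
  by apply: continuous_pair_at; [exact: cvg_id | exact: cst_continuous].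
exists U, (fun c => sc (N (g (c, 1)))^-1 (g (c, 1))); split => // c Uc; split.
- apply: lb_sc_continuous_at; last exact: cg1.
  apply: continuousV_at; first by rewrite gt_eqF // g1.
  apply: (@continuous_comp_at _ _ _ (fun c => g (c, 1)) N); first exact: cg1.
  exact: cN.
- by rewrite lb_sc_p; have [] := gP (c, 1) Uc.
- have h := g1 _ Uc; rewrite NM ger0_norm ?invr_ge0 ?ltW // mulVf //.
  exact: lt0r_neq0.
Qed.

(** The ratio of two unit vectors in one fibre is a sign. Along the paths it varies continuously and
    never vanishes, so the intermediate value theorem makes it equal at both ends. *)
Lemma unit_sign_path (u v : RR -> E) : continuous u -> continuous v ->
  (forall t, p (u t) = p (v t)) -> (forall t, N (u t) = 1) ->
  (forall t, N (v t) = 1) ->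
  exists2 c, `|c| = 1 & u 0 = sc c (v 0) /\ u 1 = sc c (v 1).
Proof.
move=> cu cv puv Nu Nv.
have /choice[s sP] : forall t, exists c, `|c| = 1 /\ u t = sc c (v t).
  move=> t; have [c c1 uE] := unit_vectors (Nv t) (Nu t) (esym (puv t)).
  by exists c.
have cs : continuous s.
  move=> t; have [F [V [oV Vb cF hF iF]]] := lb_functional (p (v t)).
  have nF e : N e = 1 -> V (p e) -> F e != 0.
    by move=> Ne Ve; apply: (lb_functional_eq0 hF iF) => //; exact: unit_nonzero.
  have cFv : continuous (F \o v).
    by move=> t'; apply: (continuous_comp_at (cv t')); exact: cF.
  have cFu : continuous (F \o u).
    by move=> t'; apply: (continuous_comp_at (cu t')); exact: cF.
  (* Near [t] the ratio is a quotient of values of one functional that is nonzero on unit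
     vectors. *)
  apply: (@near_eq_continuous_at _ _ (fun t' => F (u t') * (F (v t'))^-1) s t).
    have : nbhs t ((p \o v) @^-1` V).
      apply: (@continuous_comp _ _ _ v p t (cv t) (@lb_p_cont _ L _)).
      exact: open_nbhs_nbhs.
    apply: filterS => t' /= Vt'; have [_ ->] := sP t'.
    by rewrite hF mulfK // nF.
  apply: (@continuousM_at _ (F \o u) (fun t => (F (v t))^-1) t); first exact: cFu.
  by apply: (@continuousV_at _ (F \o v) t); [exact: nF | exact: cFv].
suff s01 : s 0 = s 1.
  exists (s 0); first by have [] := sP 0.
  by split; [have [] := sP 0 | rewrite s01; have [] := sP 1].
have sE t : s t = 1 \/ s t = -1.
  by have [+ _] := sP t; exact: norm1_sign.
apply: contrapT => s01.
have [] : exists2 c, c \in `[0, 1] & s c = 0.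
  apply: IVT => //; first exact: continuous_subspaceT.
  by case: (sE 0) (sE 1) s01 => -> [] -> // _;
    rewrite ge_min le_max lerN10 ler01 ?orbT.
move=> c _ sc0; have [+ _] := sP c.
by rewrite sc0 normr0 => /eqP; rewrite eq_sym oner_eq0.
Qed.

End Norm.
End LineBundle.

(** * Unit sections over the cube *)

Section UnitSection.
Variables (B : topologicalType) (L : line_bundle B) (N : lb_E L -> RR).
Hypothesis hausB : hausdorff_space B.
Hypothesis compB : compact [set: B].
Hypothesis normN : lb_norm N.
Local Notation E := (lb_E L).
Local Notation p := (@lb_p B L).
Local Notation sc := (@lb_sc B L).
Variable n : nat.
Implicit Types (a b : 'I_n -> RR) (x y : Rn n).

Definition segment x y (t : RR) : Rn n := fun i => x i + t * (y i - x i).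

Definition convex_region (K : set (Rn n)) : Prop :=
  forall x y t, K x -> K y -> 0 <= t <= 1 -> K (segment x y t).

(** The sign at one base point is carried to every other point of [K] along the segment joining
    them. *)
Lemma unit_sign_convex (K : set (Rn n)) (u v : Rn n -> E) :
  convex_region K -> continuous u -> continuous v ->
  (forall x, K x -> [/\ p (u x) = p (v x), N (u x) = 1 & N (v x) = 1]) ->
  exists2 c, `|c| = 1 & forall x, K x -> u x = sc c (v x).
Proof.
move=> convK cu cv uvK.
have [[x0 Kx0]|K0] := pselect (exists x, K x); last first.
  by exists 1; [rewrite normr1 | move=> x Kx; case: K0; exists x].
have [pu0 Nu0 Nv0] := uvK _ Kx0.
have [c c1 u0] := unit_vectors hausB compB normN Nv0 Nu0 (esym pu0).
exists c => // x Kx.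
(* Paths must be defined for all real times, so time is first retracted to the unit interval. *)
pose r (t : RR) : RR := Num.max 0 (Num.min 1 t).
have r01 t : 0 <= r t <= 1.
  by rewrite /r le_max lexx /= ge_max ler01 ge_min lexx.
have cr : continuous r.
  apply: continuous_maxr; first exact: cst_continuous.
  by apply: continuous_minr; [exact: cst_continuous | exact: (fun t => cvg_id)].
pose g t := segment x0 x (r t).
have cg : continuous g.
  apply: prod_topology_continuous => i t.
  apply: (@continuousD_at _ (fun=> x0 i) (fun t => r t * (x i - x0 i)) t).
    exact: cst_continuous.
  apply: (@continuousM_at _ r (fun=> x i - x0 i) t); first exact: cr.
  exact: cst_continuous.
have Kg t : K (g t) by apply: convK.
have [|||||c' _] := @unit_sign_path B L hausB compB N normN (u \o g) (v \o g).
- by move=> t; apply: (continuous_comp_at (cg t)); exact: cu.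
- by move=> t; apply: (continuous_comp_at (cg t)); exact: cv.
- by move=> t; have [] := uvK _ (Kg t).
- by move=> t; have [] := uvK _ (Kg t).
- by move=> t; have [] := uvK _ (Kg t).
have g0 : g 0 = x0.
  apply/funext => i; rewrite /g /segment /r (min_idPr ler01) maxxx.
  by rewrite mul0r addr0.
have g1 : g 1 = x.
  apply/funext => i; rewrite /g /segment /r minxx (max_idPr ler01).
  by rewrite mul1r addrC subrK.
rewrite /= g0 g1 => -[+ ->]; rewrite u0.
by move/(lb_sc_inj hausB compB (unit_nonzero normN Nv0)) => ->.
Qed.

Variable Q : Rn n -> B.
Hypothesis cQ : continuous Q.

Definition has_unit_section a b : Prop :=
  exists2 s : Rn n -> E, continuous s &
    forall x, box a b x -> p (s x) = Q x /\ N (s x) = 1.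

Definition upd (f : 'I_n -> RR) (i : 'I_n) (c : RR) : 'I_n -> RR :=
  fun k => if k == i then c else f k.

Lemma segment_between (r r' s s' t : RR) :
  r <= s <= r' -> r <= s' <= r' -> 0 <= t <= 1 -> r <= s + t * (s' - s) <= r'.
Proof.
move=> /andP[h1 h2] /andP[h3 h4] /andP[t0 t1].
have e : s + t * (s' - s) = (1 - t) * s + t * s' by ring.
have u0 : 0 <= 1 - t by rewrite subr_ge0.
rewrite e; apply/andP; split.
  have -> : r = (1 - t) * r + t * r by ring.
  by apply: lerD; apply: ler_wpM2l.
have -> : r' = (1 - t) * r' + t * r' by ring.
by apply: lerD; apply: ler_wpM2l.
Qed.

Lemma convex_box a b : convex_region (box a b).
Proof. by move=> x y t bx By t01 i; exact: segment_between (bx i) (By i) t01. Qed.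

Lemma convex_regionI (K K' : set (Rn n)) :
  convex_region K -> convex_region K' -> convex_region (K `&` K').
Proof. by move=> c c' x y t [? ?] [? ?] t01; split; [exact: c|exact: c']. Qed.

(** The two half boxes meet in the wall where coordinate [i] equals [c]. This wall is convex, so the
    two sections differ there by one constant sign; multiplying the second section by that sign
    makes them agree. *)
Lemma glue_unit_sections a b (i : 'I_n) (c : RR) :
  (forall k, a k <= b k) -> a i <= c <= b i ->
  has_unit_section a (upd b i c) -> has_unit_section (upd a i c) b ->
  has_unit_section a b.
Proof.
move=> ab /andP[ac cb] [s1 c1 s1P] [s2 c2 s2P].
have ab1 k : a k <= upd b i c k by rewrite /upd; case: eqP => [->|].
have a2b k : upd a i c k <= b k by rewrite /upd; case: eqP => [->|].
pose K := box a (upd b i c) `&` box (upd a i c) b.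
have [||||e e1 s12] := @unit_sign_convex K s1 s2.
- by apply: convex_regionI; exact: convex_box.
- exact: c1.
- exact: c2.
- by move=> x [/s1P[-> ->] /s2P[-> ->]].
have [_ NM _ _] := normN.
pose f1 x := s1 (clamp a (upd b i c) x).
pose f2 x := sc e (s2 (clamp (upd a i c) b x)).
have cf1 : continuous f1.
  by move=> x; apply: (continuous_comp_at (@clamp_continuous _ _ _ x)); exact: c1.
have cf2 : continuous f2.
  move=> x; rewrite /f2.
  apply: (@lb_sc_continuous_at B L _ (fun=> e)
    (fun x => s2 (clamp (upd a i c) b x)) x); first exact: cst_continuous.
  by apply: (continuous_comp_at (@clamp_continuous _ _ _ x)); exact: c2.
pose f x := if x i <= c then f1 x else f2 x.
exists f; last first.
  move=> x bx; rewrite /f; case: (lerP (x i) c) => xc.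
    have bx1 : box a (upd b i c) x.
      move=> k; have /andP[axk xbk] := bx k; rewrite axk /upd /=.
      by case: eqP => [->|].
    by rewrite /f1 clamp_id //; exact: s1P.
  have bx2 : box (upd a i c) b x.
    move=> k; have /andP[axk xbk] := bx k; rewrite xbk andbT /upd.
    by case: eqP => [->|//]; exact: ltW.
  by rewrite /f2 clamp_id // lb_sc_p NM e1 mul1r; exact: s2P.
have ci := @coord_continuous n i.
apply/continuous_subspace_setT.
have -> : [set: Rn n] = [set x | x i <= c] `|` [set x | c <= x i].
  apply/seteqP; split => x _ //=; case: (lerP (x i) c) => h; first by left.
  by right; exact: ltW.
apply: withinU_continuous.
- by apply: (@closed_comp _ _ (fun x : Rn n => x i) [set r | r <= c]);
    [move=> x _; exact: ci | exact: closed_le].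
- by apply: (@closed_comp _ _ (fun x : Rn n => x i) [set r | c <= r]);
    [move=> x _; exact: ci | exact: closed_ge].
- apply: (@subspace_eq_continuous _ _ _ f1); last exact: continuous_subspaceT.
  by move=> x; rewrite inE /= /from_subspace /f => xc; rewrite ifT.
- apply: (@subspace_eq_continuous _ _ _ f2); last exact: continuous_subspaceT.
  move=> x; rewrite inE /= /from_subspace /f => cx; case: (lerP (x i) c) => // xc.
  have xE : x i = c by apply/eqP; rewrite eq_le xc.
  (* The point may lie outside the box in other coordinates, but on the hyperplane both clamps send
     it to the same point of the wall. *)
  have clE : clamp a (upd b i c) x = clamp (upd a i c) b x.
    apply/funext => k; rewrite /clamp /upd; case: eqP => [->|//].
    by rewrite xE minxx (min_idPr cb) maxxx (max_idPr ac).
  rewrite /f1 /f2 -clE s12 //; split; first exact: clamp_box.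
  by rewrite clE; exact: clamp_box.
Qed.

(** A Lebesgue number argument: local unit sections of the bundle pull back to small boxes, and
    compactness of the cube makes the admissible size uniform in the lower corner. *)
Lemma small_boxes_unit_section : exists2 d : RR, 0 < d &
  forall a b, cube (a : Rn n) -> (forall i, a i <= b i <= a i + d) ->
  has_unit_section a b.
Proof.
pose P (d : RR) (x : Rn n) := forall b, (forall i, x i <= b i <= x i + d) ->
  has_unit_section x b.
have : \forall d \near 0^'+, (@cube n) `<=` P d.
  apply: (proj1 (@compact_near_coveringP (Rn n) _) (@compact_cube n)).
  move=> x0 _.
  have [U [s [oU Ux0 sP]]] := local_unit_section normN (Q x0).
  have /nbhs_box_ball[e e0 eU] : nbhs x0 (Q @^-1` U).
    by apply: cQ; exact: open_nbhs_nbhs.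
  have e20 : 0 < e / 2 by rewrite divr_gt0.
  exists (box_ball x0 (e / 2), [set d | d < e / 2]).
    split; first exact: box_ball_nbhs.
    exact: nbhs_right_lt.
  move=> [x d] [/= xx0 de] b bP.
  have bx y : box x b y -> U (Q y).
    move=> yb; apply: eU => i.
    have /andP[h1 h2] := yb i; have /andP[h3 h4] := bP i.
    have h5 := xx0 i; rewrite ltr_norml in h5; have /andP[h6 h7] := h5.
    by rewrite ltr_norml; apply/andP; split; lra.
  have xb i : x i <= b i by have /andP[] := bP i.
  exists (s \o (Q \o clamp x b)); last first.
    by move=> y yb; rewrite /= clamp_id //; have [] := sP _ (bx _ yb).
  move=> y; have Uy : U (Q (clamp x b y)) by apply: bx; exact: clamp_box.
  apply: (@continuous_comp_at _ _ _ (Q \o clamp x b) s y).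
    by apply: (continuous_comp_at (@clamp_continuous _ _ _ y)); exact: cQ.
  by have [] := sP _ Uy.
case/nbhs_ballP => e e0 eP; exists (e / 2); first by rewrite divr_gt0.
move=> a b ca ab; apply: (eP (e / 2)) => //; last by rewrite divr_gt0.
rewrite /ball /= sub0r normrN ger0_norm ?divr_ge0 ?ltW //.
by rewrite gtr_pMr // invf_lt1 ?ltr1n.
Qed.

(** Boxes are halved until they are small enough for a local section, and the sections are glued
    back wall by wall. *)
Lemma box_unit_section a b : cube (a : Rn n) -> cube (b : Rn n) ->
  (forall i, a i <= b i) -> has_unit_section a b.
Proof.
move=> ca0 cb0 ab0.
have [d d0 small] := small_boxes_unit_section.
(* [m] counts the rounds of halving; one round halves every coordinate. *)
have bisect m : forall a b, cube (a : Rn n) -> cube (b : Rn n) ->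
    (forall i, a i <= b i) -> (forall i, b i - a i <= d * 2 ^+ m) ->
    has_unit_section a b.
  elim: m => [|m IH] {ca0 cb0 ab0} {}a {}b ca cb ab wid.
    by apply: small => // i; rewrite ab addrC -lerBlDr; have := wid i; rewrite mulr1.
  (* Within a round, [l] lists the coordinates that may still need halving. *)
  suff coords (l : seq 'I_n) : forall a b, cube (a : Rn n) -> cube (b : Rn n) ->
      (forall i, a i <= b i) -> (forall i, b i - a i <= d * 2 ^+ m.+1) ->
      (forall i, i \notin l -> b i - a i <= d * 2 ^+ m) -> has_unit_section a b.
    by apply: (coords (enum 'I_n)) => // i; rewrite mem_enum.
  elim: l => [|i l IHl] {wid ab ca cb} {}a {}b ca cb ab wid widl.
    by apply: IH => // i; exact: widl.
  pose c := (a i + b i) / 2.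
  have aibi := ab i.
  have ac : a i <= c by rewrite /c; lra.
  have cb' : c <= b i by rewrite /c; lra.
  have cc : - quarter <= c <= quarter.
    have /andP[h1 _] := ca i; have /andP[_ h2] := cb i.
    by rewrite (le_trans h1 ac) (le_trans cb' h2).
  have half : (b i - a i) / 2 <= d * 2 ^+ m.
    by have := wid i; rewrite exprS; set w := 2 ^+ m; lra.
  have le2 : d * 2 ^+ m <= d * 2 ^+ m.+1.
    by rewrite ler_pM2l // exprS ler_peMl ?exprn_ge0 // ler1n.
  apply: (@glue_unit_sections a b i c) => //; first by rewrite ac.
    apply: IHl => // [k|k|k|k kl]; rewrite /upd; case: eqP => [E|/eqP ki]; rewrite ?E //.
    - by apply: le_trans le2; apply: le_trans half; rewrite /c; lra.
    - by apply: le_trans half; rewrite /c; lra.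
    - by apply: widl; rewrite inE negb_or ki.
  apply: IHl => // [k|k|k|k kl]; rewrite /upd; case: eqP => [E|/eqP ki]; rewrite ?E //.
  - by apply: le_trans le2; apply: le_trans half; rewrite /c; lra.
  - by apply: le_trans half; rewrite /c; lra.
  - by apply: widl; rewrite inE negb_or ki.
(* This [m] exceeds [d^-1], and [2 ^+ m] exceeds [m], so the width bound is at least 1, while the
   sides of the box have length at most 1. *)
apply: (bisect (Num.bound d^-1)) => // i.
have /andP[h1 _] := ca0 i; have /andP[_ h2] := cb0 i.
have wid1 : b i - a i <= 1.
  have : quarter <= 2^-1 by rewrite /quarter lef_pV2 ?posrE // ler_nat.
  by move=> hq; lra.
apply: (le_trans wid1); rewrite mulrC -ler_pdivrMr // div1r.
have := @archi_boundP RR d^-1; rewrite invr_ge0 => /(_ (ltW d0)) /ltW h.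
by apply: (le_trans h); rewrite -natrX ler_nat ltnW // ltn_expl.
Qed.

Lemma cube_unit_section : exists2 s : Rn n -> E, continuous s &
  forall x, cube x -> p (s x) = Q x /\ N (s x) = 1.
Proof.
apply: (@box_unit_section (fun=> - quarter) (fun=> quarter)).
- by move=> i; rewrite lexx ge0_cp // quarter_ge0.
- by move=> i; rewrite lexx andbT ge0_cp // quarter_ge0.
- by move=> i; rewrite ge0_cp // quarter_ge0.
Qed.

End UnitSection.

(** * Projectivizations and projective coordinates on the cube *)

Lemma hausdorff_separated (X : topologicalType) :
  (forall x y : X, x <> y -> exists (Z : topologicalType) (f : X -> Z),
     [/\ hausdorff_space Z, continuous f & f x <> f y]) -> hausdorff_space X.
Proof.
move=> sep x y xy; apply: contrapT => /sep[Z [f [hZ cf fxy]]]; apply: fxy.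
apply: hZ => A B fA fB.
by have [z [Az Bz]] := xy _ _ (cf _ _ fA) (cf _ _ fB); exists (f z).
Qed.

(** * Quotient maps from a subset *)

Section QuotientMapOn.
Variables (X Y : topologicalType) (W : set X) (q : X -> Y)
  (r : X -> X -> Prop).
Hypothesis qP : quotient_map_on W q r.

Lemma quotient_map_on_lift (Z : topologicalType) (F : X -> Z) :
  (forall x, W x -> {for x, continuous F}) ->
  (forall x x', W x -> W x' -> r x x' -> F x = F x') ->
  exists2 f : Y -> Z, continuous f & forall x, W x -> f (q x) = F x.
Proof.
move=> cF rF; have [surj qr oq] := qP.
have /choice[g gP] : forall y, exists x, W x /\ q x = y.
  by move=> y; have [x Wx qx] := surj y; exists x.
have fq x : W x -> F (g (q x)) = F x.
  move=> Wx; have [Wg qg] := gP (q x).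
  by apply: rF => //; apply/(qr _ _ Wg Wx).
exists (F \o g) => //; apply/continuousP => O oO; apply/oq.
(* [F] is continuous only at points of [W], so its preimage of [O] need not be open; its interior
   has the same trace on [W]. *)
exists ((F @^-1` O)^°); split; first exact: open_interior.
apply/seteqP; split => x [/= Ox Wx]; split => //.
  by rewrite /= fq //; exact: (interior_subset Ox).
by rewrite fq // in Ox; apply: cF => //; exact: open_nbhs_nbhs.
Qed.

Lemma quotient_map_on_continuous (T : topologicalType) (h : T -> X) :
  continuous h -> (forall t, W (h t)) -> continuous (q \o h).
Proof.
move=> ch Wh; have [_ _ oq] := qP.
apply/continuousP => O /oq[V [oV VO]].
rewrite (_ : _ @^-1` O = h @^-1` V); first by apply: open_comp => // t _; exact: ch.
apply/seteqP; split => t /= Ot.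
  by have [] : (V `&` W) (h t) by rewrite VO.
by have [] : (q @^-1` O `&` W) (h t) by rewrite -VO.
Qed.
End QuotientMapOn.

(** A continuous map from a compact set to a Hausdorff space is closed: the complement of [U] is the
    image of the compact set of points of [K] outside [V]. *)
Lemma compact_hausdorff_quotient_open (T X : topologicalType) (K : set T)
  (f : T -> X) : compact K -> hausdorff_space X -> continuous f ->
  (forall y, exists2 x, K x & f x = y) ->
  forall U : set X,
    open U <-> exists V : set T, open V /\ V `&` K = f @^-1` U `&` K.
Proof.
move=> cK hX cf sf U; split=> [oU|[V [oV VU]]].
  by exists (f @^-1` U); split=> //; apply: open_comp => // x _; exact: cf.
rewrite -(setCK U); apply: closed_openC.
have -> : ~` U = f @` (K `&` ~` V).
  apply/seteqP; split => [y nUy|_ [x [Kx nVx] <-] Ux].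
    have [x Kx fx] := sf y; exists x => //; split => // Vx; apply: nUy.
    have [] : (f @^-1` U `&` K) x by rewrite -VU.
    by rewrite /= fx.
  by apply: nVx; have [] : (V `&` K) x by rewrite VU.
apply: compact_closed => //; apply: continuous_compact.
  exact: continuous_subspaceT.
by apply: compact_closedI => //; exact: open_closedC.
Qed.

Lemma dependent_choice (I : Type) (T : I -> Type) (P : forall i, T i -> Prop) :
  (forall i, exists x, P i x) -> exists f : forall i, T i, forall i, P i (f i).
Proof.
by move=> h; exists (fun i => projT1 (cid (h i))) => i; exact: projT2 (cid _).
Qed.

Section ProjectivizationHausdorff.
Variables (B X : topologicalType) (k : nat) (L : 'I_k.+1 -> line_bundle B).
Hypothesis hausB : hausdorff_space B.
Hypothesis compB : compact [set: B].
Variable q : prod_topology (fun i => lb_E (L i)) -> X.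
Hypothesis qP : quotient_map_on (@whitney_nonzero B k L) q (@proj_rel B k L).
Local Notation E := (prod_topology (fun i => lb_E (L i))).

(* Points over the same [b] are separated by the entries of [v v^T / |v|^2],
   where [v] are the coordinates given by functionals injective over [b]. *)
Lemma projectivization_hausdorff : hausdorff_space X.
Proof.
have cpr i : continuous (fun e : E => e i).
  exact: (@proj_prod_continuous _ (fun i => lb_E (L i))).
have [surj qr _] := qP.
have /dependent_choice[N NP] : forall i, exists N, @lb_norm B (L i) N.
  by move=> i; exact: lb_norm_exists.
have N0 i e : 0 <= N i e by have [_ _ + _] := NP i; exact.
have NM i c e : N i (lb_sc c e) = `|c| * N i e by have [_ + _ _] := NP i; exact.
(* The functionals chosen later may vanish on fibres away from [b]. This denominator, built from
   global norms, is nonzero on all nonzero vectors and homogeneous of degree 2, so the matrix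
   entries are functions on [X]. *)
pose D (e : E) := \sum_(i <- enum 'I_k.+1) N i (e i) * N i (e i).
have D0 (e : E) : whitney_nonzero e -> D e != 0.
  move=> [_ [i ei]]; rewrite /D big_enum /= (bigD1 i) //=.
  have := lb_norm_gt0 (NP i) ei => h.
  rewrite gt_eqF // ltr_pwDl ?mulr_gt0 // sumr_ge0 // => j _; exact: mulr_ge0.
have DM c (e : E) : D (fun i => lb_sc c (e i)) = c ^+ 2 * D e.
  rewrite /D mulr_sumr; apply: eq_bigr => i _.
  by rewrite NM mulrACA -normrM -expr2 ger0_norm // sqr_ge0.
have cD : continuous D.
  move=> e; apply: (@continuous_sum_at _ _ _
    (fun i (e : E) => N i (e i) * N i (e i)) e) => i.
  have cNi : {for e, continuous (fun e : E => N i (e i))}.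
    apply: (continuous_comp_at (cpr i e)).
    by have [+ _ _ _] := NP i; exact.
  exact: continuousM_at.
apply: hausdorff_separated => u u' uu'.
have [e We qe] := surj u; have [e' We' qe'] := surj u'.
have [pe|pe] := pselect (lb_p (e ord0) = lb_p (e' ord0)); last first.
  have [||f cf fP] := quotient_map_on_lift qP (F := fun e : E => lb_p (e ord0)).
  - by move=> x _; apply: (continuous_comp_at (cpr ord0 x)); exact: lb_p_cont.
  - by move=> x x' _ _ [c _ ->]; rewrite lb_sc_p.
  by exists B, f; split=> //; rewrite -qe -qe' !fP.
set b := lb_p (e ord0) in pe.
have /dependent_choice[F FP] : forall i, exists F : lb_E (L i) -> RR,
    [/\ continuous F, (forall c e, F (lb_sc c e) = c * F e) &
      forall e e', lb_p e = b -> lb_p e' = b -> F e = F e' -> e = e'].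
  move=> i; have [F [V [_ Vb cF hF iF]]] := lb_functional (L i) hausB compB b.
  by exists F; split => // x x' xb x'b; apply: iF; rewrite ?xb.
pose G i j (e : E) := F i (e i) * F j (e j) * (D e)^-1.
have [//|Gne] := pselect (exists i j, G i j e <> G i j e').
  move=> [i [j Gij]].
  have [||f cf fP] := quotient_map_on_lift qP (F := G i j).
  - move=> x Wx; have cFi l : {for x, continuous (fun e : E => F l (e l))}.
      apply: (continuous_comp_at (cpr l x)).
      by have [+ _ _] := FP l; exact.
    apply: (@continuousM_at _ (fun e : E => F i (e i) * F j (e j))
      (fun e => (D e)^-1) x).
      exact: continuousM_at.
    by apply: (@continuousV_at _ D x); [exact: D0 | exact: cD].
  - move=> x x' _ _ [c /eqP c0 ->]; rewrite /G DM.
    have [_ -> _] := FP i; have [_ -> _] := FP j.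
    by rewrite mulrACA -expr2 invfM mulrACA divff ?mul1r // expf_neq0.
  by exists RR, f; split=> //; [exact: Rhausdorff | rewrite -qe -qe' !fP].
exfalso; apply: uu'; rewrite -qe -qe'; apply/(qr _ _ We We').
have GE i j : G i j e = G i j e'.
  by apply: contrapT => h; apply: Gne; exists i, j.
have over i : lb_p (e i) = b by case: We.
have over' i : lb_p (e' i) = b by rewrite pe; case: We'.
have [l el] : exists i, e i <> lb_sc 0 (e i) by case: We.
have Fl : F l (e l) != 0.
  apply/eqP => F0; apply: el; have [_ hF iF] := FP l.
  by apply: iF; rewrite ?lb_sc_p // hF mul0r.
have De := D0 _ We; have De' := D0 _ We'.
have Fl' : F l (e' l) != 0.
  apply/eqP => F0; have /eqP := GE l l.
  by rewrite /G F0 !mul0r mulf_eq0 invr_eq0 (negbTE De) orbF mulf_eq0 orbb (negbTE Fl).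
(* Comparing column [l] of the two equal matrices gives this ratio of [F i (e' i)] to [F i (e i)],
   the same for every [i]. *)
exists (F l (e l) * D e' / (D e * F l (e' l))).
  by apply/eqP; rewrite !(mulf_neq0, invr_neq0).
apply: functional_extensionality_dep => i; have [_ hF iF] := FP i.
apply: iF; rewrite ?lb_sc_p // hF.
have := GE i l; rewrite /G => /(congr1 (fun z => z * D e' / F l (e' l))).
rewrite divfK // mulfK // => <-.
by rewrite invfM; ring.
Qed.

End ProjectivizationHausdorff.

(** * Sup norm and homogeneous coordinates of projective space *)

Section SupNorm.
Variable k : nat.
Implicit Types (y : 'I_k -> RR) (c r : RR).

Definition supn y : RR := \big[Num.max/0]_m `|y m|.

Lemma le_supn y m : `|y m| <= supn y.
Proof. exact: le_bigmax. Qed.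

Lemma supn_ge0 y : 0 <= supn y.
Proof. exact: bigmax_ge_id. Qed.

Lemma supn_le y r : 0 <= r -> (forall m, `|y m| <= r) -> supn y <= r.
Proof. by move=> r0 yr; apply: bigmax_le. Qed.

Lemma eq_supn y y' : (forall m, `|y m| = `|y' m|) -> supn y = supn y'.
Proof. by move=> yy'; apply: eq_bigr => m _. Qed.

Lemma supn_scale c y : supn (fun m => c * y m) = `|c| * supn y.
Proof.
apply/le_anti/andP; split.
  apply: supn_le => [|m]; first by rewrite mulr_ge0 ?supn_ge0.
  by rewrite normrM ler_wpM2l // le_supn.
have [->|c0] := eqVneq c 0; first by rewrite normr0 mul0r supn_ge0.
rewrite mulrC -ler_pdivlMr ?normr_gt0 //; apply: supn_le => [|m].
  by rewrite divr_ge0 ?supn_ge0.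
by rewrite ler_pdivlMr ?normr_gt0 // mulrC -normrM (le_supn (fun m => c * y m)).
Qed.

Lemma supn_attained y : supn y = 0 \/ exists m, supn y = `|y m|.
Proof.
rewrite /supn; elim/big_ind: _ => [|r r'|m _]; [by left| |by right; exists m].
by move=> h h'; rewrite /Num.max; case: ifP.
Qed.

Lemma supn_continuous : continuous (fun y : Rn k => supn y).
Proof.
rewrite /supn /index_enum; elim: (Finite.enum _) => [|m l IH].
  rewrite (_ : (fun y => _) = fun=> 0); first exact: cst_continuous.
  by apply/funext => y; rewrite big_nil.
rewrite (_ : (fun y => _) = (fun y : Rn k =>
    Num.max `|y m| (\big[Num.max/0]_(m <- l) `|y m|))).
  apply: continuous_maxr IH => y.
  apply: (@continuous_norm_at _ (fun y : Rn k => y m)).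
  exact: coord_continuous.
by apply/funext => y; rewrite big_cons.
Qed.

(* Homogeneous coordinates of the point of RP^k represented by a point [y] of
   the cube: [y] is shifted to height [1/4 - |y|] and projected radially, so
   the boundary of the cube is the hyperplane at infinity. *)
Definition proj_coord y (i : 'I_k.+1) : RR :=
  if unlift ord0 i is Some m then y m else quarter - supn y.

Lemma proj_coord0 y : proj_coord y ord0 = quarter - supn y.
Proof. by rewrite /proj_coord unlift_none. Qed.

Lemma proj_coordS y m : proj_coord y (lift ord0 m) = y m.
Proof. by rewrite /proj_coord liftK. Qed.

Lemma proj_coord_continuous i : continuous (fun y : Rn k => proj_coord y i).
Proof.
rewrite /proj_coord; case: unlift => [m|]; first exact: coord_continuous.
move=> y; apply: (@continuousD_at _ (fun=> quarter) (fun y : Rn k => - supn y) y).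
  exact: cst_continuous.
by apply: (@continuousN RR RR^o _ (fun y : Rn k => supn y) y); exact: supn_continuous.
Qed.

Lemma proj_coord_neq0 y : exists i, proj_coord y i != 0.
Proof.
have [s0|s0] := eqVneq (supn y) 0.
  by exists ord0; rewrite proj_coord0 s0 subr0 gt_eqF // quarter_gt0.
case: (supn_attained y) => [/eqP|[m ym]]; first by rewrite (negbTE s0).
by exists (lift ord0 m); rewrite proj_coordS -normr_eq0 -ym.
Qed.

Lemma supn_cube y : cube (y : Rn k) -> supn y <= quarter.
Proof. by move/cube_normP => cy; apply: supn_le => //; exact: quarter_ge0. Qed.

Lemma proj_coordN y m : cube (y : Rn k) -> `|y m| = quarter ->
  forall i, proj_coord (fun m => - y m) i = - proj_coord y i.
Proof.
move=> cy ym i; have sy : supn y = quarter.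
  by apply/le_anti; rewrite supn_cube // -ym le_supn.
have sNy : supn (fun m => - y m) = quarter.
  by rewrite -sy; apply: eq_supn => l; rewrite normrN.
rewrite /proj_coord; case: unlift => [//|].
by rewrite sy sNy subrr oppr0.
Qed.

Lemma supn_sign y (c : 'I_k -> RR) : (forall m, `|c m| = 1) ->
  supn (fun m => c m * y m) = supn y.
Proof. by move=> c1; apply: eq_supn => m; rewrite normrM c1 mul1r. Qed.

(** On the cube, [proj_coord] takes as values the vectors with nonnegative zeroth coordinate for
    which that coordinate plus the sup norm of the others is 1/4. Every nonzero vector is brought to
    this form by a sign and a positive scaling. *)
Lemma proj_coord_surj (v : 'I_k.+1 -> RR) : (exists i, v i != 0) ->
  exists y c, [/\ cube (y : Rn k), c != 0 & forall i, proj_coord y i = c * v i].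
Proof.
move=> [i0 vi0]; pose v' m := v (lift ord0 m).
pose D := `|v ord0| + supn v'.
have D0 : 0 < D.
  have [v0|v0] := eqVneq (v ord0) 0; last by rewrite ltr_pwDl ?supn_ge0 ?normr_gt0.
  case: (unliftP ord0 i0) vi0 => [m ->|->]; last by rewrite v0 eqxx.
  rewrite -normr_gt0 => h; rewrite /D v0 normr0 add0r.
  exact: lt_le_trans h (le_supn v' m).
pose s : RR := if 0 <= v ord0 then 1 else -1.
have s1 : `|s| = 1 by rewrite /s; case: ifP; rewrite ?normrN normr1.
have sv : s * v ord0 = `|v ord0|.
  by rewrite /s; case: ger0P => _; rewrite ?mul1r ?mulN1r.
pose c := s * (quarter / D).
have qD : 0 < quarter / D by rewrite divr_gt0 ?quarter_gt0.
have nc : `|c| = quarter / D by rewrite normrM s1 mul1r gtr0_norm.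
exists (fun m => c * v' m), c; split.
- apply/cube_normP => m; rewrite normrM nc mulrAC ler_pdivrMr // ler_wpM2l ?quarter_ge0 //.
  by rewrite /D; apply: le_trans (le_supn v' m) _; rewrite lerDr.
- by rewrite -normr_eq0 nc gt_eqF.
- move=> i; case: (unliftP ord0 i) => [m ->|->]; first by rewrite proj_coordS.
  have -> : c * v ord0 = `|v ord0| * (quarter / D) by rewrite /c mulrAC sv.
  rewrite proj_coord0 supn_scale nc.
  by move: (lt0r_neq0 D0); rewrite /D => Dn; field.
Qed.

(** Height plus sup norm is 1/4 for both points, so a scalar [c >= 0] must be 1. If [c < 0],
    nonnegativity of both heights makes them vanish; then [y] lies on the boundary and [c = -1]. *)
Lemma proj_coord_inj y y' c : cube (y : Rn k) -> cube (y' : Rn k) ->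
  (forall i, proj_coord y' i = c * proj_coord y i) ->
  y' = y \/ (exists m, `|y m| = quarter) /\ y' = (fun m => - y m).
Proof.
move=> cy cy' h.
have yE m : y' m = c * y m by have := h (lift ord0 m); rewrite !proj_coordS.
have sE : supn y' = `|c| * supn y.
  by rewrite -supn_scale; apply: eq_supn => m; rewrite yE.
have := h ord0; rewrite !proj_coord0 sE => h0.
have := supn_cube cy; have := supn_cube cy'; have := supn_ge0 y.
rewrite sE => s0 sy' sy; have q0 := quarter_gt0.
case: (lerP 0 c) h0 sy' => c0.
  rewrite ger0_norm // => h0 sy'.
  have c1 : c = 1.
    have : (c - 1) * quarter = 0 by lra.
    by move/eqP; rewrite mulf_eq0 (gt_eqF q0) orbF subr_eq0 => /eqP.
  by left; apply/funext => m; rewrite yE c1 mul1r.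
rewrite ltr0_norm // => h0 sy'.
have syq : supn y = quarter.
  have le1 : c * (quarter - supn y) <= 0.
    by apply: mulr_le0_ge0; [exact: ltW | rewrite subr_ge0].
  have /eqP : c * (quarter - supn y) = 0 by lra.
  by rewrite mulf_eq0 (lt_eqF c0) subr_eq0 => /eqP.
have cN1 : c = -1.
  have : (c + 1) * quarter = 0 by rewrite syq in h0; lra.
  by move/eqP; rewrite mulf_eq0 (gt_eqF q0) orbF addr_eq0 => /eqP.
right; split; last by apply/funext => m; rewrite yE cN1 mulN1r.
case: (supn_attained y) => [s00|[m ym]]; last by exists m; rewrite -ym.
by move: q0; rewrite -syq s00 ltxx.
Qed.

End SupNorm.

(** * The inductive step *)

Section BlockMatrix.
Variables (d k : nat) (A : 'M['F_2]_d) (e : 'I_d -> 'I_k -> RR).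
Hypothesis e_sign : forall j m, e j m = 1 \/ e j m = -1.

Definition bott_matrix : 'M['F_2]_(d + k) :=
  block_mx A (\matrix_(j, m) if e j m == -1 then 1 else 0)
           0 (\matrix_(m, m') if m == m' then 0 else 1).

Lemma bott_matrix_diag : (forall j, A j j = 0) -> forall i, bott_matrix i i = 0.
Proof.
move=> A0 i; rewrite /bott_matrix; case: (split_ordP i) => j ->.
  by rewrite block_mxEul.
by rewrite block_mxEdr mxE eqxx.
Qed.

Lemma tsign_ll j j' : tsign bott_matrix (lshift k j) (lshift k j') = tsign A j j'.
Proof. by rewrite /tsign /msign block_mxEul (inj_eq (@lshift_inj _ _)). Qed.

Lemma tsign_lr j m : tsign bott_matrix (lshift k j) (rshift d m) = e j m.
Proof.
rewrite /tsign /msign block_mxEur mxE eq_rlshift.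
have n1 : (1 == -1 :> RR) = false by rewrite eq_sym (negbTE N1_neq1).
by case: (e_sign j m) => ->; rewrite ?n1 ?eqxx.
Qed.

Lemma tsign_rl m j : tsign bott_matrix (rshift d m) (lshift k j) = 1.
Proof. by rewrite /tsign /msign block_mxEdl mxE eq_lrshift. Qed.

Lemma tsign_rr m m' : tsign bott_matrix (rshift d m) (rshift d m') = -1.
Proof.
rewrite /tsign /msign block_mxEdr mxE (inj_eq (@rshift_inj _ _)) eq_sym.
by case: eqP.
Qed.

Definition lefts (l : seq 'I_(d + k)) : seq 'I_d :=
  pmap (fun i : 'I_(d + k) => if fintype.split i is inl j then Some j else None) l.

Definition rights_sign (l : seq 'I_(d + k)) : RR :=
  \prod_(i <- l) (if fintype.split i is inr _ then -1 else 1).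

Lemma split_lshift j : fintype.split (lshift k j : 'I_(d + k)) = inl j.
Proof. exact: (unsplitK (inl j)). Qed.

Lemma split_rshift m : fintype.split (rshift d m : 'I_(d + k)) = inr m.
Proof. exact: (unsplitK (inr m)). Qed.

Lemma sgn_left l j : sgn bott_matrix l (lshift k j) = sgn A (lefts l) j.
Proof.
elim: l => [|i l IH]; first by rewrite !sgn_nil.
rewrite sgn_cons IH /lefts /=; case: (split_ordP i) => i' ->.
  by rewrite ?split_lshift /= sgn_cons tsign_ll.
by rewrite ?split_rshift /= tsign_rl mul1r.
Qed.

Lemma sgn_right l m : sgn bott_matrix l (rshift d m) =
  \prod_(j <- lefts l) e j m * rights_sign l.
Proof.
elim: l => [|i l IH]; first by rewrite sgn_nil /rights_sign !big_nil mulr1.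
rewrite sgn_cons IH /lefts /rights_sign /= big_cons.
case: (split_ordP i) => i' ->.
  by rewrite ?split_lshift /= big_cons tsign_lr mul1r mulrA.
by rewrite ?split_rshift /= tsign_rr mulrCA.
Qed.

(** The old letters of the word satisfy the hypothesis for [A], so their composite is the identity
    and their signs [e] cancel. Every new coordinate then carries the same sign, the parity of the
    number of new letters. If a new letter occurs, the assumption at that letter makes this sign 1;
    otherwise the product is empty. *)
Lemma bott_matrix_support_detects : support_detects_identity A ->
  (forall l m, (forall j, sgn A l j = 1) -> \prod_(j <- l) e j m = 1) ->
  support_detects_identity bott_matrix.
Proof.
move=> goodA e_hom l hl.
have lefts1 j : sgn A (lefts l) j = 1.
  apply: goodA => {}j; rewrite /lefts mem_pmap => /mapP[i il].
  case: (split_ordP i) il => i' -> il; last by rewrite ?split_rshift.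
  by rewrite ?split_lshift => -[->]; rewrite -sgn_left hl.
move=> i; case: (split_ordP i) => i' ->; first by rewrite sgn_left.
rewrite sgn_right e_hom // mul1r.
have [/hasP[r rl]|nr] := boolP (has (fun i : 'I_(d + k) =>
    if fintype.split i is inr _ then true else false) l).
  case: (split_ordP r) rl => r' -> rl; first by rewrite ?split_lshift.
  by have := hl _ rl; rewrite sgn_right e_hom // mul1r.
rewrite /rights_sign big1_seq // => r /= rl.
by have := hasPn nr _ rl; case: (fintype.split r).
Qed.

Definition join_coords (x : Rn d) (y : Rn k) : Rn (d + k) :=
  fun i => match fintype.split i with inl j => x j | inr m => y m end.

Definition lpart (z : Rn (d + k)) : Rn d := fun j => z (lshift k j).
Definition rpart (z : Rn (d + k)) : Rn k := fun m => z (rshift d m).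

Lemma join_left x y j : join_coords x y (lshift k j) = x j.
Proof. by rewrite /join_coords split_lshift. Qed.

Lemma join_right x y m : join_coords x y (rshift d m) = y m.
Proof. by rewrite /join_coords split_rshift. Qed.

Lemma join_parts z : join_coords (lpart z) (rpart z) = z.
Proof.
apply/funext => i; case: (split_ordP i) => j ->.
  by rewrite join_left.
by rewrite join_right.
Qed.

Lemma lpart_join x y : lpart (join_coords x y) = x.
Proof. by apply/funext => j; rewrite /lpart join_left. Qed.

Lemma rpart_join x y : rpart (join_coords x y) = y.
Proof. by apply/funext => j; rewrite /rpart join_right. Qed.

Lemma cube_join x y : cube (join_coords x y) <-> cube x /\ cube y.
Proof.
split=> [c|[cx cy] i].
  by split=> i; [have := c (lshift k i) | have := c (rshift d i)];
    rewrite ?join_left ?join_right.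
by case: (split_ordP i) => j ->; rewrite ?join_left ?join_right.
Qed.

Lemma cube_parts z : cube z <-> cube (lpart z) /\ cube (rpart z).
Proof. by rewrite -{1}(join_parts z) cube_join. Qed.

Lemma tau_join_left j b x y : tau bott_matrix (lshift k j, b) (join_coords x y) =
  join_coords (tau A (j, b) x) (fun m => e j m * y m).
Proof.
apply/funext => i; rewrite tauE /=; case: (split_ordP i) => i' ->.
  by rewrite !join_left tsign_ll tauE.
by rewrite !join_right tsign_lr.
Qed.

Lemma tau_join_right m b x y : tau bott_matrix (rshift d m, b) (join_coords x y) =
  join_coords x (fun m => - y m).
Proof.
apply/funext => i; rewrite tauE /=; case: (split_ordP i) => i' ->.
  by rewrite !join_left tsign_rl mul1r.
by rewrite !join_right tsign_rr mulN1r.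
Qed.

Lemma norm_e j m : `|e j m| = 1.
Proof. by case: (e_sign j m) => ->; rewrite ?normrN normr1. Qed.

Lemma seal_rel_join x x' y : seal_rel A x x' -> cube y ->
  exists2 y', cube y' & seal_rel bott_matrix (join_coords x y) (join_coords x' y').
Proof.
move=> [[j b] [[cx xj] ->]] cy; exists (fun m => e j m * y m).
  apply/cube_normP => m; rewrite normrM norm_e mul1r.
  by move: m; apply/cube_normP.
exists (lshift k j, b); rewrite tau_join_left; split => //.
by split; [apply/cube_join | rewrite /= join_left].
Qed.

Lemma seal_equiv_sym n (A' : 'M['F_2]_n) x y :
  seal_equiv A' x y -> seal_equiv A' y x.
Proof. exact: Relation_Operators.rst_sym. Qed.

Lemma seal_equiv_trans n (A' : 'M['F_2]_n) x y z :
  seal_equiv A' x y -> seal_equiv A' y z -> seal_equiv A' x z.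
Proof. exact: Relation_Operators.rst_trans. Qed.

(** Equivalences of the base cube lift to the larger cube at the cost of changing signs in [y]. Both
    directions are carried so that the symmetry case of the induction is immediate. *)
Lemma seal_equiv_join x x' : seal_equiv A x x' ->
  (forall y, cube y -> exists2 y', cube y' &
    seal_equiv bott_matrix (join_coords x y) (join_coords x' y')) /\
  (forall y, cube y -> exists2 y', cube y' &
    seal_equiv bott_matrix (join_coords x' y) (join_coords x y')).
Proof.
elim=> {x x'} [x x' xx'|x|x x' _ [IH1 IH2]|x x' x'' _ [IH1 IH2] _ [IH3 IH4]].
- split=> y cy; [have [y' cy' h] := seal_rel_join xx' cy
                |have [y' cy' h] := seal_rel_join (seal_rel_sym xx') cy];
    by exists y' => //; exact: Relation_Operators.rst_step.
- by split=> y cy; exists y => //; exact: Relation_Operators.rst_refl.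
- by [].
- split=> y cy.
    have [y1 /IH3[y2 cy2 h2] h1] := IH1 y cy.
    by exists y2 => //; exact: seal_equiv_trans h1 h2.
  have [y1 /IH2[y2 cy2 h2] h1] := IH4 y cy.
  by exists y2 => //; exact: seal_equiv_trans h1 h2.
Qed.

End BlockMatrix.

(** The induction invariant. Strongness appears in its sign form, which passes to block matrices;
    Hausdorffness feeds the bump functions and the closed-map argument of the next stage. *)
Definition cubical_model (n : nat) (X : topologicalType) : Prop :=
  exists A : 'M['F_2]_n,
    [/\ (forall i, A i i = 0), support_detects_identity A,
        hausdorff_space X & homeomorphic_to_seal_space A X].

(** * Cubical model of a projectivization *)

Section Step.
Variables (d k : nat) (B X : topologicalType) (L : 'I_k.+1 -> line_bundle B).
Variables (A : 'M['F_2]_d) (q : Rn d -> B).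
Hypothesis A0 : forall i, A i i = 0.
Hypothesis goodA : support_detects_identity A.
Hypothesis hausB : hausdorff_space B.
Hypothesis qP : quotient_map_on (@cube d) q (seal_equiv A).
Variable qX : prod_topology (fun i => lb_E (L i)) -> X.
Hypothesis qXP : quotient_map_on (@whitney_nonzero B k L) qX (@proj_rel B k L).

(** The quotient map is constrained only on the cube; clamping first makes it continuous
    everywhere. *)
Let Q : Rn d -> B := q \o @cube_clamp d.

Let cQ : continuous Q.
Proof.
apply: (quotient_map_on_continuous qP); last exact: cube_clampP.
exact: clamp_continuous.
Qed.

Let QE x : cube x -> Q x = q x.
Proof. by move=> cx; rewrite /Q /= cube_clamp_id. Qed.

Let compB : compact [set: B].
Proof.
have <- : Q @` (@cube d) = [set: B].
  apply/seteqP; split=> // b _; have [surj _ _] := qP.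
  by have [x cx <-] := surj b; exists x; rewrite ?QE.
apply: continuous_compact; last exact: compact_cube.
exact: continuous_subspaceT.
Qed.

Let Q_tau j x : facet j x -> Q (tau A j x) = Q x.
Proof.
move=> fx; have cx := facet_cube fx; have ct := tau_cube A j cx.
rewrite !QE //; have [_ qr _] := qP; apply/(qr _ _ ct cx).
by apply: seal_equiv_sym; apply: Relation_Operators.rst_step; exists j.
Qed.

Section UnitSections.
Variables (N : forall i, lb_E (L i) -> RR)
  (s : forall i, Rn d -> lb_E (L i)).
Hypothesis NP : forall i, lb_norm (@N i).
Hypothesis sP : forall i,
  [/\ continuous (@s i), forall x, lb_p (s i x) = Q x &
      forall x, N (s i x) = 1].

Let cs i : continuous (s i). Proof. by have [] := sP i. Qed.
Let ps i x : lb_p (s i x) = Q x. Proof. by have [_ + _] := sP i; exact. Qed.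
Let Ns i x : N (s i x) = 1. Proof. by have [_ _ +] := sP i; exact. Qed.
Let s_neq0 i x : s i x <> lb_sc 0 (s i x).
Proof. exact: (unit_nonzero (NP i) (Ns i x)). Qed.

(** On the convex facet [(j, true)] the section and its transport by [tau] are unit vectors in the
    same fibres, so they differ by a constant sign. The opposite facet gets the same sign, because
    [tau] is an involution and a sign is its own inverse. *)
Lemma unit_section_sign i j : exists2 c, c = 1 \/ c = -1 &
  forall b x, facet (j, b) x -> s i (tau A (j, b) x) = lb_sc c (s i x).
Proof.
have ctau : continuous (tau A (j, true)).
  apply: prod_topology_continuous => m x.
  rewrite (_ : (fun u => _) = fun x : Rn d => tsign A j m * x m); last first.
    by apply/funext => y; rewrite tauE.
  apply: (@continuousM_at _ (fun=> tsign A j m) (fun x : Rn d => x m) x).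
    exact: cst_continuous.
  exact: coord_continuous.
have [||||c c1 cP] := @unit_sign_convex B (L i) (@N i) hausB compB (NP i) d
    (facet (j, true)) (s i \o tau A (j, true)) (s i).
- move=> x y t [cx xj] [cy yj] t01; split; last first.
    by rewrite /segment xj yj subrr mulr0 addr0.
  by apply: (@convex_box d (fun=> - quarter) (fun=> quarter)).
- by move=> x; apply: (continuous_comp_at (ctau x)); exact: cs.
- exact: cs.
- by move=> x fx; split; [rewrite /= !ps Q_tau | exact: Ns | exact: Ns].
have c_sign := norm1_sign c1.
exists c => // -[x fx|x fx]; first exact: cP.
have := cP _ (tau_facet A fx); rewrite /= tau_tau => ->.
rewrite (lb_scA hausB compB) (_ : c * c = 1) ?(lb_sc1 hausB compB) //.
by case: c_sign => ->; rewrite ?mulrNN mulr1.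
Qed.

Section Signs.
Variable c : 'I_k.+1 -> 'I_d -> RR.
Hypothesis c_sign : forall i j, c i j = 1 \/ c i j = -1.
Hypothesis cP : forall i j b x, facet (j, b) x ->
  s i (tau A (j, b) x) = lb_sc (c i j) (s i x).

(** A corner lies on a facet in every direction and stays a corner, so any word [l] can be followed
    from it with suitable choices of side. *)
Lemma corner_holonomy i (l : seq 'I_d) (x : Rn d) :
  (forall m, `|x m| = quarter) ->
  exists2 ks : seq (sidx d), map fst ks = l &
    s i (tau_seq A ks x) = lb_sc (\prod_(j <- l) c i j) (s i x).
Proof.
elim: l x => [|j l IH] x cx.
  by exists [::] => //=; rewrite big_nil (lb_sc1 hausB compB).
have [b xb] := norm_quarterP (cx j).
have fx : facet (j, b) x.
  by split => //; apply/cube_normP => m; rewrite cx.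
have [|ks ksl ksE] := IH (tau A (j, b) x).
  by move=> m; rewrite tauE normrM norm_tsign mul1r.
exists ((j, b) :: ks); first by rewrite /= ksl.
by rewrite /= ksE (cP _ fx) (lb_scA hausB compB) big_cons mulrC.
Qed.

(* Transporting a fibre along a closed path of [tau]'s at a corner of the cube
   shows that the signs of a line bundle respect the relations among them. *)
Lemma holonomy_trivial i (l : seq 'I_d) : (forall j, sgn A l j = 1) ->
  \prod_(j <- l) c i j = 1.
Proof.
move=> l1; have [|ks ksl] := @corner_holonomy i l (fun=> quarter).
  by move=> m; rewrite gtr0_norm // quarter_gt0.
have -> : tau_seq A ks (fun=> quarter) = (fun=> quarter).
  by apply/funext => m; rewrite tau_seqE ksl l1 mul1r.
rewrite -[LHS](lb_sc1 hausB compB) => h.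
by apply/esym; apply: (lb_sc_inj hausB compB (@s_neq0 i _) h).
Qed.

(** Crossing facet [j] multiplies each section by its sign. Rescaling by the sign of the zeroth one
    keeps the height coordinate nonnegative and leaves this product on coordinate [m]. *)
Let e (j : 'I_d) (m : 'I_k) : RR := c ord0 j * c (lift ord0 m) j.

Let e_sign j m : e j m = 1 \/ e j m = -1.
Proof.
rewrite /e; case: (c_sign ord0 j) => ->; case: (c_sign (lift ord0 m) j) => ->;
  rewrite ?mulrNN ?mul1r ?mulr1; by [left|right].
Qed.

Let A' := bott_matrix A e.

Definition fibre_vector (z : Rn (d + k)) : prod_topology (fun i => lb_E (L i)) :=
  fun i => lb_sc (proj_coord (rpart z) i) (s i (lpart z)).

Lemma fibre_vector_continuous : continuous fibre_vector.
Proof.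
apply: prod_topology_continuous => i z.
have cl : continuous (@lpart d k).
  by apply: prod_topology_continuous => j; exact: coord_continuous.
have cr : continuous (@rpart d k).
  by apply: prod_topology_continuous => j; exact: coord_continuous.
apply: (@lb_sc_continuous_at B (L i) _ (fun z => proj_coord (rpart z) i)
  (fun z => s i (lpart z)) z).
  apply: (@continuous_comp_at _ _ _ (@rpart d k)
    (fun y : Rn k => proj_coord y i) z (cr z)).
  exact: proj_coord_continuous.
by apply: (@continuous_comp_at _ _ _ (@lpart d k) (s i) z (cl z)); exact: cs.
Qed.

Lemma fibre_vector_nonzero z : whitney_nonzero (fibre_vector z).
Proof.
split; first by move=> i; rewrite !lb_sc_p !ps.
have [i wi] := proj_coord_neq0 (rpart z); exists i.
rewrite /fibre_vector (lb_scA hausB compB) mul0r.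
by move/(lb_sc_inj hausB compB (@s_neq0 i _))/eqP; rewrite (negbTE wi).
Qed.

Let Phi := qX \o fibre_vector.

Lemma Phi_seal_rel z z' : seal_rel A' z z' -> Phi z = Phi z'.
Proof.
move=> [[i b] [[cz zi] ->]]; have [_ qr _] := qXP.
apply/(qr _ _ (fibre_vector_nonzero _) (fibre_vector_nonzero _)).
have [cx cy] := proj1 (cube_parts z) cz.
rewrite -(join_parts z) in zi *.
move: (lpart z) (rpart z) cx cy zi => x y cx cy {z cz}.
case: (split_ordP i) => j ->.
  rewrite /= join_left => zi.
  rewrite (tau_join_left A e_sign).
  have fx : facet (j, b) x by [].
  exists (c ord0 j).
    by case: (c_sign ord0 j) => ->; apply/eqP; rewrite ?oppr_eq0 oner_eq0.
  apply: functional_extensionality_dep => m.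
  rewrite /fibre_vector !lpart_join !rpart_join (cP _ fx) !(lb_scA hausB compB).
  congr lb_sc; rewrite /proj_coord; case: unliftP => [m' ->|->]; last first.
    rewrite (supn_sign _ (c := e j)) 1?mulrC // => m'; exact: norm_e.
  rewrite /e; case: (c_sign (lift ord0 m') j) => ->; ring.
rewrite /= join_right => yj; rewrite (tau_join_right A e).
exists (-1); first by apply/eqP; rewrite oppr_eq0 oner_eq0.
apply: functional_extensionality_dep => m.
rewrite /fibre_vector !lpart_join !rpart_join (lb_scA hausB compB) mulN1r.
by rewrite (@proj_coordN _ y j) // yj; exact: norm_side.
Qed.

(** Points with the same image lie over the same point of [B], so their base coordinates are
    equivalent. Lifting that equivalence moves [z'] to a point with the same base coordinates as
    [z], without changing its image. Within one fibre cube, [proj_coord_inj] leaves only equality or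
    the antipodal identification of the boundary. *)
Lemma Phi_seal_equiv z z' : cube z -> cube z' ->
  Phi z = Phi z' <-> seal_equiv A' z z'.
Proof.
move=> cz cz'; split; last first.
  elim=> {z z' cz cz'} [z z'|//|z z' _ ->//|z z' z'' _ -> _ ->//].
  exact: Phi_seal_rel.
have [_ qr _] := qXP.
move/(qr _ _ (fibre_vector_nonzero _) (fibre_vector_nonzero _)).
have [cx cy] := proj1 (cube_parts z) cz.
have [cx' cy'] := proj1 (cube_parts z') cz'.
rewrite -(join_parts z) -(join_parts z').
move: (lpart z) (rpart z) (lpart z') (rpart z') cx cy cx' cy' => x y x' y'.
move=> cx cy cx' cy' {z z' cz cz'} Rzz'.
have qxx' : q x' = q x.
  move: Rzz' => [r _ /(congr1 (fun f => lb_p (f ord0)))].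
  by rewrite !lb_sc_p !ps !lpart_join !QE.
have xx' : seal_equiv A x' x by have [_ + _] := qP; move=> <-.
have [+ _] := seal_equiv_join e_sign xx'.
move=> /(_ y' cy')[y'' cy'' h''].
apply: seal_equiv_trans (seal_equiv_sym h'').
have Phi_eq : Phi (join_coords x y) = Phi (join_coords x y'').
  transitivity (Phi (join_coords x' y')).
    by apply/(qr _ _ (fibre_vector_nonzero _) (fibre_vector_nonzero _)).
  elim: h'' => [z z'|//|z z' _ ->//|z z' z'' _ -> _ ->//].
  exact: Phi_seal_rel.
move/(qr _ _ (fibre_vector_nonzero _) (fibre_vector_nonzero _)): Phi_eq => [r _ E].
have [] := @proj_coord_inj k y y'' r cy cy''.
- move=> i; have := congr1 (fun f => f i) E.
  rewrite /fibre_vector !lpart_join !rpart_join (lb_scA hausB compB).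
  exact: (lb_sc_inj hausB compB (@s_neq0 i _)).
- by move=> ->; exact: Relation_Operators.rst_refl.
move=> [[m ym] ->]; apply: Relation_Operators.rst_step.
rewrite -(tau_join_right A e m true).
apply: seal_relP; last by rewrite join_right.
exact/cube_join.
Qed.

Lemma Phi_surjective u : exists2 z, cube z & Phi z = u.
Proof.
have [surj qr _] := qXP; have [surjB _ _] := qP.
have [f Wf <-] := surj u; have [x cx qx] := surjB (lb_p (f ord0)).
have /choice[v vP] : forall i, exists r, f i = lb_sc r (s i x).
  move=> i; apply: (lb_span hausB compB (@s_neq0 i x)).
  by rewrite ps QE // qx; have [-> _] := Wf.
have [|y [r [cy r0 yE]]] := @proj_coord_surj k v.
  have [_ [i fi]] := Wf; exists i; apply/eqP => vi; apply: fi.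
  by rewrite vP vi (lb_scA hausB compB) mul0r.
exists (join_coords x y); first exact/cube_join.
apply/esym/(qr _ _ Wf (fibre_vector_nonzero _)).
exists r; first exact/eqP.
apply: functional_extensionality_dep => i.
by rewrite /fibre_vector lpart_join rpart_join yE vP (lb_scA hausB compB).
Qed.

Lemma cubical_model_of_signs : cubical_model (d + k) X.
Proof.
have hX := projectivization_hausdorff hausB compB qXP.
have cPhi : continuous Phi.
  exact: (quotient_map_on_continuous qXP fibre_vector_continuous fibre_vector_nonzero).
exists A'; split => //.
- exact: bott_matrix_diag.
- apply: bott_matrix_support_detects => // l m l1.
  by rewrite /e big_split /= !holonomy_trivial // mulr1.
- exists Phi; split; first exact: Phi_surjective.
    exact: Phi_seal_equiv.
  apply: compact_hausdorff_quotient_open => //; first exact: compact_cube.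
  exact: Phi_surjective.
Qed.

End Signs.
End UnitSections.

Lemma cubical_model_projectivization : cubical_model (d + k) X.
Proof.
have /dependent_choice[N NP] : forall i, exists N, @lb_norm B (L i) N.
  by move=> i; exact: lb_norm_exists.
have /dependent_choice[s sP] : forall i, exists s : Rn d -> lb_E (L i),
    [/\ continuous s, forall x, lb_p (s x) = Q x & forall x, N i (s x) = 1].
  move=> i; have [s cs sP] := cube_unit_section hausB compB (NP i) cQ.
  exists (s \o @cube_clamp d); split=> x.
  - by apply: (continuous_comp_at (@clamp_continuous _ _ _ x)); exact: cs.
  - have [-> _] := sP _ (cube_clampP x).
    by rewrite QE //; exact: cube_clampP.
  - by have [_ ->] := sP _ (cube_clampP x).
have /choice[c cP] : forall ij : 'I_k.+1 * 'I_d, exists c : RR,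
    (c = 1 \/ c = -1) /\ forall b x, facet (ij.2, b) x ->
      s ij.1 (tau A (ij.2, b) x) = lb_sc c (s ij.1 x).
  by move=> [i j]; have [c c1 cP] := unit_section_sign NP sP i j; exists c.
apply: (@cubical_model_of_signs N s NP sP (fun i j => c (i, j))).
- by move=> i j; have [] := cP (i, j).
- by move=> i j; have [] := cP (i, j).
Qed.

End Step.

(** * Induction along the tower *)

Lemma cubical_model_point (X : topologicalType) :
  (exists x : X, forall y, y = x) -> cubical_model 0 X.
Proof.
move=> [x0 xP]; exists 0; split.
- by case.
- by move=> l _ [].
- by move=> x y _; rewrite (xP x) (xP y).
have eq0 (x y : Rn 0) : x = y by apply/funext => -[].
exists (fun=> x0); split.
- by move=> y; exists (fun=> 0); [case | rewrite (xP y)].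
- move=> x y _ _; split=> // _; rewrite (eq0 x y).
  exact: Relation_Operators.rst_refl.
- move=> U; have [Ux|nUx] := pselect (U x0).
    have -> : U = [set: X] by apply/seteqP; split=> // y _; rewrite (xP y).
    by split=> _; [exists [set: Rn 0]; split; [exact: openT|] | exact: openT].
  have -> : U = set0 by apply/seteqP; split=> // y; rewrite (xP y).
  by split=> _; [exists set0; split; [exact: open0|] | exact: open0].
Qed.

Lemma gen_real_bott_cubical_model (n : nat) (X : topologicalType) :
  gen_real_bott n X -> cubical_model n X.
Proof.
elim=> {n X} [X|d k B X L _ [A [A0 goodA hB [q qP]]] [qX qXP]].
  exact: cubical_model_point.
exact: (cubical_model_projectivization A0 goodA hB qP qXP).
Qed.

Theorem mainTheorem17 (n : nat) (M : topologicalType) :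
  gen_real_bott n M ->
  exists A : 'M['F_2]_n,
    [/\ (forall i, A i i = 0), strong A & homeomorphic_to_seal_space A M].
Proof.
move=> /gen_real_bott_cubical_model[A [A0 goodA _ hq]]; exists A; split => //.
exact: support_detects_identity_strong.
Qed.
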